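(* Let $X$ be a Hausdorff space and $L:X\times X\to[1,\infty)$ a continuous log-conditional kernel. For the kernel $H_{L}:X\times X\to\mathbb{R}$, $H_{L}(x,y):=L(x,y)^{-1}$: $H_{L}$ is strictly positive definite (SPD) if and only if $L$ is metrizable; likewise, $H_{L}$ is universal if and only if $L$ is metrizable.
   Context: A kernel $\gamma:X\times X\to\mathbb{R}$ is conditionally negative definite if $\gamma(x,y)=\gamma(y,x)$ and $\sum_{\mu,\nu=1}^{n}c_{\mu}c_{\nu}\gamma(x_{\mu},x_{\nu})\le 0$ for all finitely many distinct points $x_{1},\dots,x_{n}$ and $c_{1},\dots,c_{n}\in\mathbb{R}$ with $\sum_{\mu}c_{\mu}=0$. Such a $\gamma$ is metrizable if $2\gamma(x,y)>\gamma(x,x)+\gamma(y,y)$ for all $x\neq y$ in $X$. A symmetric kernel $L:X\times X\to[1,\infty)$ is log-conditional if $\log L(x,y)$ is conditionally negative definite; a log-conditional kernel $L$ is metrizable if $\log L$ is metrizable. A kernel $K:X\times X\to\mathbb{C}$ is positive definite if $\sum_{\mu,\nu=1}^{n}c_{\mu}\overline{c_{\nu}}K(x_{\mu},x_{\nu})\ge 0$ for all finitely many distinct points $x_{\mu}\in X$ and scalars $c_{\mu}\in\mathbb{C}$, and strictly positive definite (SPD) if moreover the sum vanishes only when all $c_{\mu}=0$. Its reproducing kernel Hilbert space $\mathcal{H}_{K}$ is the Hilbert space of functions $F:X\to\mathbb{C}$ that contains $K_{y}:=K(\cdot,y)$ for every $y\in X$, satisfies $\langle F,K_{y}\rangle_{\mathcal{H}_{K}}=F(y)$,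 and in which $\mathrm{span}\{K_{y}:y\in X\}$ is dense. A positive definite kernel $K$ on a Hausdorff space $X$ is universal if $\mathcal{H}_{K}\subset C(X)$ and for every compact $\mathcal{C}\subset X$, continuous $g:\mathcal{C}\to\mathbb{C}$ and $\epsilon>0$ there is $f\in\mathcal{H}_{K}$ with $\sup_{x\in\mathcal{C}}|f(x)-g(x)|<\epsilon$. *)

(* Defs.v *)
From HB Require Import structures.
From mathcomp Require Import all_boot all_order all_algebra.
From mathcomp Require Import complex.
From mathcomp Require Import all_classical all_reals all_analysis.

Set Implicit Arguments.
Unset Strict Implicit.
Unset Printing Implicit Defensive.

Import Order.TTheory GRing.Theory Num.Theory.
Import numFieldNormedType.Exports.

Local Open Scope classical_set_scope.
Local Open Scope ring_scope.

(* The type ascription is what gives R[i] the topology of its modulus: that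
   topology is declared on the carrier of an arbitrary numClosedFieldType, not
   on [complex R]. *)
Definition cplx (R : realType) : numClosedFieldType := R[i].

Section RealKernels.
Context {R : realType} {X : Type}.
Implicit Types gamma L : X -> X -> R.

Definition symmetric_kernel gamma := forall x y, gamma x y = gamma y x.

Definition cond_negative_definite gamma :=
  symmetric_kernel gamma /\
  forall (n : nat) (x : 'I_n -> X) (c : 'I_n -> R),
    injective x -> \sum_(i < n) c i = 0 ->
    \sum_(i < n) \sum_(j < n) c i * c j * gamma (x i) (x j) <= 0.

Definition metrizable gamma :=
  forall x y, x <> y -> gamma x x + gamma y y < 2 * gamma x y.

Definition log_kernel L : X -> X -> R := fun x y => ln (L x y).

Definition log_conditional L :=
  [/\ forall x y, 1 <= L x y,
      symmetric_kernel L &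
      cond_negative_definite (log_kernel L)].

Definition log_metrizable L := metrizable (log_kernel L).

Definition inverse_kernel L : X -> X -> R := fun x y => (L x y)^-1.

End RealKernels.

Section ComplexKernels.
Context {R : realType} {X : Type}.
Local Notation C := (cplx R).
Implicit Types K : X -> X -> C.

Definition to_complex (k : X -> X -> R) : X -> X -> C :=
  fun x y => real_complex R (k x y).

Definition quadratic_form K (n : nat) (x : 'I_n -> X) (c : 'I_n -> C) : C :=
  \sum_(i < n) \sum_(j < n) c i * Num.conj (c j) * K (x i) (x j).

(* In the order of R[i], [0 <= z] says that z is real and nonnegative. *)
Definition positive_definite K :=
  forall (n : nat) (x : 'I_n -> X) (c : 'I_n -> C),
    injective x -> 0 <= quadratic_form K x c.

Definition strictly_positive_definite K :=
  positive_definite K /\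
  forall (n : nat) (x : 'I_n -> X) (c : 'I_n -> C),
    injective x -> quadratic_form K x c = 0 -> forall i, c i = 0.

Definition ip_norm (ip : (X -> C) -> (X -> C) -> C) (F : X -> C) : R :=
  Num.sqrt (complex.Re (ip F F)).

(* A Hilbert space of functions is a set H of functions with an inner product;
   ip is a total function, whose values off H are irrelevant. *)
Record hilbert_function_space (H : set (X -> C))
    (ip : (X -> C) -> (X -> C) -> C) : Prop := HilbertFunctionSpace {
  hfs_zero : H 0;
  hfs_lin : forall (a : C) F G, H F -> H G -> H (a *: F + G);
  ip_linear : forall (a : C) F G E, H F -> H G -> H E ->
    ip (a *: F + G) E = a * ip F E + ip G E;
  ip_hermitian : forall F G, H F -> H G -> ip G F = Num.conj (ip F G);
  ip_ge0 : forall F, H F -> 0 <= ip F F;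
  ip_eq0 : forall F, H F -> ip F F = 0 -> F = 0;
  hfs_complete : forall u : nat -> X -> C, (forall n, H (u n)) ->
    (forall e : R, 0 < e -> exists N : nat, forall m n : nat,
       (N <= m)%N -> (N <= n)%N -> ip_norm ip (u m - u n) < e) ->
    exists2 F, H F & (fun n => ip_norm ip (u n - F)) @ \oo --> (0 : R)
}.

Definition kernel_section K (y : X) : X -> C := fun x => K x y.

Definition kernel_span K : set (X -> C) :=
  [set F | exists (n : nat) (c : 'I_n -> C) (y : 'I_n -> X),
     F = \sum_(i < n) c i *: kernel_section K (y i)].

Record is_rkhs K (H : set (X -> C)) (ip : (X -> C) -> (X -> C) -> C) : Prop :=
  IsRKHS {
  rkhs_hilbert : hilbert_function_space H ip;
  rkhs_section : forall y, H (kernel_section K y);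
  rkhs_reproducing : forall F y, H F -> ip F (kernel_section K y) = F y;
  rkhs_dense : forall F, H F -> forall e : R, 0 < e ->
    exists2 G, kernel_span K G & ip_norm ip (F - G) < e
}.

End ComplexKernels.

(* The space H_K exists and is unique for positive definite K, so quantifying
   existentially over (H, ip) speaks about H_K.  A continuous g on the compact
   set A is represented by a total function continuous in the subspace topology
   of A. *)
Definition universal_kernel {R : realType} {X : topologicalType}
    (K : X -> X -> cplx R) :=
  positive_definite K /\
  exists (H : set (X -> cplx R)) (ip : (X -> cplx R) -> (X -> cplx R) -> cplx R),
    [/\ is_rkhs K H ip,
        forall F, H F -> continuous F &
        forall (A : set X) (g : X -> cplx R) (e : R),
          compact A -> {within A, continuous g} -> 0 < e ->
          exists2 f, H f &
            (ereal_sup [set (complex.Re `|f x - g x|)%:E | x in A] < e%:E)%E].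

(* Main.v *)
Require Import Defs.
From HB Require Import structures.
From mathcomp Require Import all_boot all_order all_algebra.
From mathcomp Require Import complex.
From mathcomp Require Import all_classical all_reals all_analysis.
From mathcomp Require Import ring lra.

(* Write g = log L and fix z in X.  The centered kernel
     k(x, y) = g(x, z) + g(z, y) - g(x, y) - g(z, z)
   is positive definite, and 1/L(x, y) = f(x) f(y) exp(k(x, y)) with f > 0, so
   1/L is positive definite by Schur's product theorem.  Metrizability says
   exactly that the sections of k separate points.

   Call p dominated by a kernel q if C q - p(x) p(y) is positive definite for
   some C; this is membership of p in the RKHS of q.  All polynomials in the
   sections of k are dominated by exp(k), so f times this algebra lies in the
   RKHS of 1/L.  If L is metrizable the algebra separates points: interpolating
   on finite sets gives strict positive definiteness, and Stone-Weierstrass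
   gives universality.  If L is not metrizable, some two sections of 1/L are
   proportional, which contradicts both properties. *)

Set Implicit Arguments.
Unset Strict Implicit.
Unset Printing Implicit Defensive.

Import Order.TTheory GRing.Theory Num.Theory.
Import numFieldNormedType.Exports.

Local Open Scope classical_set_scope.
Local Open Scope ring_scope.

(** * Real positive semidefinite kernels *)

(** Metrizability enters through k(x,x) + k(y,y) - 2 k(x,y) = 2 g(x,y) - g(x,x) - g(y,y). The left
    side vanishes if neither [k x] nor [k y] distinguishes x from y. The right side is never
    negative, by conditional negative definiteness at delta_x - delta_y, so a failure of
    metrizability is an equality and makes a two by two Gram matrix of 1/L singular. The algebra is
    defined by domination rather than by generators. Constants and sections belong to it because the
    Taylor remainder exp(k) - 1 - k is positive definite, products because of Schur's theorem.
    Universality asserts that a Hilbert space exists, so one has to be built. It is taken as the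
    dual of the finite combinations under the seminorm given by 1/L: its elements are functions from
    the start, domination is membership, and neither a completion nor a quotient occurs. The price
    is that the inner product must be recovered from the norm by approximation. All of this is done
    over the reals; as 1/L is real, complexifying gives the complex space. *)

Lemma discriminant_le (R : realFieldType) (a b c : R) : 0 <= c ->
  (forall t, 0 <= a - 2 * t * b + t ^+ 2 * c) -> b ^+ 2 <= c * a.
Proof.
rewrite le0r => /orP[/eqP ->|c0] h.
  rewrite mul0r; have [->|b0] := eqVneq b 0; first by rewrite expr0n.
  (* If the quadratic term vanishes, a nonzero [b] leaves an affine function of t; this t gives it
     the value -1. *)
  have := h ((a + 1) / b / 2).
  have -> : a - 2 * ((a + 1) / b / 2) * b + ((a + 1) / b / 2) ^+ 2 * 0 = -1.
    by field; rewrite b0.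
  by rewrite ler0N1.
have := h (b / c).
have -> : a - 2 * (b / c) * b + (b / c) ^+ 2 * c = a - b ^+ 2 / c.
  by field; rewrite gt_eqF.
by rewrite subr_ge0 ler_pdivrMr// mulrC.
Qed.

(** The arithmetic-geometric mean inequality: it turns a Cauchy-Schwarz bound, which is a product,
    into a bound on an energy, which is a sum. *)
Lemma sqr_le_mul (R : realFieldType) (x A B : R) :
  0 <= A -> 0 <= B -> x ^+ 2 <= A * B -> 2 * x <= A + B.
Proof.
move=> A0 B0 h; rewrite leNgt; apply/negP => hx.
have : (A + B) ^+ 2 < (2 * x) ^+ 2 by rewrite ltr_pXn2r// nnegrE; lra.
by have := sqr_ge0 (A - B); nra.
Qed.

Section Combinations.
Context {R : realType} {X : Type}.
Implicit Types (F G : X -> R) (u v w : seq (R * X)) (q : X -> X -> R).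

(* A sequence of pairs (c, x) stands for the measure \sum c * delta_x. *)
Definition lin F v : R := \sum_(p <- v) p.1 * F p.2.

Definition qf q u v : R := lin (fun x => lin (q x) v) u.

Definition scale_comb (t : R) v := [seq (t * p.1, p.2) | p <- v].

Lemma lin_nil F : lin F [::] = 0.
Proof. by rewrite /lin big_nil. Qed.

Lemma lin_cons F p v : lin F (p :: v) = p.1 * F p.2 + lin F v.
Proof. by rewrite /lin big_cons. Qed.

Lemma lin_cat F u v : lin F (u ++ v) = lin F u + lin F v.
Proof. by rewrite /lin big_cat. Qed.

Lemma lin_scale F t v : lin F (scale_comb t v) = t * lin F v.
Proof.
by rewrite /lin big_map mulr_sumr; apply: eq_bigr => p _; rewrite /= mulrA.
Qed.

Lemma eq_lin F G v : F =1 G -> lin F v = lin G v.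
Proof. by move=> FG; apply: eq_bigr => p _; rewrite FG. Qed.

Lemma lin_funD a F G v : lin (fun x => a * F x + G x) v = a * lin F v + lin G v.
Proof.
rewrite /lin mulr_sumr -big_split; apply: eq_bigr => p _ /=; ring.
Qed.

Lemma lin_funM a F v : lin (fun x => a * F x) v = a * lin F v.
Proof. by rewrite /lin mulr_sumr; apply: eq_bigr => p _ /=; ring. Qed.

Lemma lin0 v : lin (fun=> 0) v = 0.
Proof. by rewrite /lin big1// => p _; rewrite mulr0. Qed.

Lemma qf_exchange q u v : qf q u v = lin (fun y => lin (q^~ y) u) v.
Proof.
rewrite /qf /lin; under eq_bigr do rewrite mulr_sumr.
rewrite exchange_big; apply: eq_bigr => p _; rewrite mulr_sumr.
by apply: eq_bigr => r _ /=; ring.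
Qed.

Lemma qf_sym q u v : (forall x y, q x y = q y x) -> qf q u v = qf q v u.
Proof.
move=> qC; rewrite qf_exchange; apply: eq_lin => x; apply: eq_lin => y.
exact: qC.
Qed.

Lemma qf_catl q u v w : qf q (u ++ v) w = qf q u w + qf q v w.
Proof. exact: lin_cat. Qed.

Lemma qf_catr q u v w : qf q w (u ++ v) = qf q w u + qf q w v.
Proof. by rewrite !(qf_exchange _ w) lin_cat. Qed.

Lemma qf_cons q p u : (forall x y, q x y = q y x) ->
  qf q (p :: u) (p :: u) =
  p.1 ^+ 2 * q p.2 p.2 + 2 * p.1 * lin (q p.2) u + qf q u u.
Proof.
move=> qC; have e w : qf q (p :: u) w = p.1 * lin (q p.2) w + qf q u w.
  exact: lin_cons.
rewrite e lin_cons (qf_sym _ _ qC) e; ring.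
Qed.

Lemma qf_scalel q t u v : qf q (scale_comb t u) v = t * qf q u v.
Proof. exact: lin_scale. Qed.

Lemma qf_scaler q t u v : qf q u (scale_comb t v) = t * qf q u v.
Proof. by rewrite !(qf_exchange _ u) lin_scale. Qed.

Lemma eq_qf q1 q2 u v : q1 =2 q2 -> qf q1 u v = qf q2 u v.
Proof. by move=> q12; apply: eq_lin => x; apply: eq_lin => y. Qed.

Lemma qf_funD a q1 q2 u v :
  qf (fun x y => a * q1 x y + q2 x y) u v = a * qf q1 u v + qf q2 u v.
Proof. by rewrite /qf -lin_funD; apply: eq_lin => x; rewrite lin_funD. Qed.

Lemma qf_funM a q u v : qf (fun x y => a * q x y) u v = a * qf q u v.
Proof. by rewrite /qf -lin_funM; apply: eq_lin => x; rewrite lin_funM. Qed.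

Lemma qf_rank1 F G u v : qf (fun x y => F x * G y) u v = lin F u * lin G v.
Proof.
rewrite /qf; under eq_lin do rewrite lin_funM mulrC.
by rewrite lin_funM mulrC.
Qed.

Lemma lin_cvg (F_ : nat -> X -> R) F v :
  (forall x, F_ n x @[n --> \oo] --> F x) ->
  lin (F_ n) v @[n --> \oo] --> lin F v.
Proof.
move=> FF; elim: v => [|p v IH].
  by rewrite lin_nil; under eq_fun do rewrite lin_nil; exact: cvg_cst.
rewrite lin_cons; under eq_fun do rewrite lin_cons.
by apply: cvgD => //; apply: cvgM => //; exact: cvg_cst.
Qed.

End Combinations.

Section RealPositiveDefinite.
Context {R : realType} {X : Type}.
Implicit Types (F G : X -> R) (u v w : seq (R * X)) (q : X -> X -> R).

Definition psd q := (forall x y, q x y = q y x) /\ forall v, 0 <= qf q v v.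

Lemma psd_ext q1 q2 : q1 =2 q2 -> psd q1 -> psd q2.
Proof.
move=> q12 [qC q0]; split=> [x y|v]; first by rewrite -!q12.
by rewrite -(eq_qf _ _ q12).
Qed.

Lemma psd0 : psd (fun _ _ => 0).
Proof.
split=> // v; rewrite /qf; under eq_lin do rewrite lin0.
by rewrite lin0.
Qed.

Lemma psd_lincomb a q1 q2 : 0 <= a -> psd q1 -> psd q2 ->
  psd (fun x y => a * q1 x y + q2 x y).
Proof.
move=> a0 [q1C q10] [q2C q20]; split=> [x y|v]; first by rewrite q1C q2C.
by rewrite qf_funD addr_ge0// mulr_ge0.
Qed.

Lemma psdD q1 q2 : psd q1 -> psd q2 -> psd (fun x y => q1 x y + q2 x y).
Proof.
by move=> p1 p2; apply: psd_ext (psd_lincomb ler01 p1 p2) => x y; rewrite mul1r.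
Qed.

Lemma psdZ a q : 0 <= a -> psd q -> psd (fun x y => a * q x y).
Proof.
by move=> a0 p; apply: psd_ext (psd_lincomb a0 p psd0) => x y; rewrite addr0.
Qed.

Lemma psd_rank1 F : psd (fun x y => F x * F y).
Proof.
by split=> [x y|v]; rewrite ?qf_rank1 -?expr2 ?sqr_ge0// mulrC.
Qed.

Lemma psd_congr F q : psd q -> psd (fun x y => F x * F y * q x y).
Proof.
case=> qC q0; split=> [x y|v]; first by rewrite qC [F x * _]mulrC.
(* The factors of the kernel are absorbed into the coefficients of the combination. *)
suff -> : qf (fun x y => F x * F y * q x y) v v =
  qf q [seq (p.1 * F p.2, p.2) | p <- v] [seq (p.1 * F p.2, p.2) | p <- v].
  exact: q0.
rewrite /qf /lin !big_map; apply: eq_bigr => p _ /=; rewrite big_map -mulrA.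
by congr (_ * _); rewrite mulr_sumr; apply: eq_bigr => r _ /=; ring.
Qed.

Lemma psd_diag_ge0 q x : psd q -> 0 <= q x x.
Proof.
by case=> _ /(_ [:: (1, x)]); rewrite /qf !lin_cons !lin_nil !mul1r !addr0.
Qed.

Lemma psd_cauchy_schwarz q x v : psd q -> lin (q x) v ^+ 2 <= q x x * qf q v v.
Proof.
move=> qP; apply: discriminant_le => [|t]; first exact: psd_diag_ge0.
case: qP => qC /(_ ((- t, x) :: v)); rewrite qf_cons//=.
by congr (0 <= _); ring.
Qed.

(** Cauchy-Schwarz read as positivity of a form. It serves twice: it eliminates a point in the Schur
    product theorem, and it shows that a section is dominated by its kernel. *)
Lemma psd_schur_complement q x : psd q ->
  psd (fun y z => q x x * q y z - q x y * q x z).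
Proof.
move=> qP; split=> [y z|v]; first by rewrite (proj1 qP) [q x y * _]mulrC.
have -> : qf (fun y z => q x x * q y z - q x y * q x z) v v =
    q x x * qf q v v - lin (q x) v ^+ 2.
  rewrite (@eq_qf _ _ _ (fun y z => q x x * q y z + (- 1 * q x y) * q x z)).
    by rewrite qf_funD qf_rank1 lin_funM; ring.
  by move=> y z; ring.
by rewrite subr_ge0 psd_cauchy_schwarz.
Qed.

(** Schur's product theorem by Gaussian elimination: induction on the combination, with the first
    kernel left general since elimination replaces it. *)
Lemma psdM q1 q2 : psd q1 -> psd q2 -> psd (fun x y => q1 x y * q2 x y).
Proof.
move=> q1P q2P; split=> [x y|v]; first by rewrite (proj1 q1P) (proj1 q2P).
elim: v q1 q1P => [|[c p] w IH] q1 q1P; first by rewrite /qf lin_nil.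
(* A point at which the first kernel degenerates does not contribute, and the
   Schur complement at p degenerates at p. *)
have degenerate q : psd q -> (forall y, q p y = 0) ->
    0 <= qf (fun x y => q x y * q2 x y) ((c, p) :: w) ((c, p) :: w).
  move=> qP q0; rewrite /qf lin_cons /=.
  rewrite (@eq_lin _ _ _ (fun=> 0)) ?lin0 ?mulr0 ?add0r; last first.
    by move=> y; rewrite q0 mul0r.
  rewrite (@eq_lin _ _ _ (fun x => lin (fun y => q x y * q2 x y) w)).
    exact: IH.
  by move=> x; rewrite lin_cons /= (proj1 qP x p) q0 mul0r mulr0 add0r.
have [q1p|q1p] := eqVneq (q1 p p) 0.
  apply: degenerate => // y.
  have := psd_cauchy_schwarz p [:: (1, y)] q1P.
  rewrite q1p mul0r lin_cons lin_nil mul1r addr0 => h.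
  by apply/eqP; rewrite -sqrf_eq0 eq_le h sqr_ge0.
have q1p0 : 0 < q1 p p by rewrite lt_def q1p psd_diag_ge0.
(* [q1 p p * q1 y z] is the Schur complement at [p] plus [q1 p y * q1 p z]. Multiplied by [q2], the
   former is handled by [degenerate] and the latter is a congruence of [q2]. *)
rewrite -(pmulr_rge0 _ q1p0).
have h1 := degenerate _ (psd_schur_complement p q1P) (fun y => subrr _).
have h2 := proj2 (psd_congr (q1 p) q2P) ((c, p) :: w).
have := addr_ge0 h1 h2; rewrite -[X in X + _]mul1r -qf_funD -qf_funM.
congr (0 <= _); apply: eq_qf => y z /=; ring.
Qed.

Lemma psd1 : psd (fun _ _ => 1).
Proof. by apply: psd_ext (psd_rank1 (fun=> 1)) => x y; rewrite mul1r. Qed.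

Lemma psdX q n : psd q -> psd (fun x y => q x y ^+ n).
Proof.
move=> qP; elim: n => [|n IH]; first exact: psd1.
by apply: psd_ext (psdM qP IH) => x y; rewrite exprS.
Qed.

Lemma psd_lim (q_ : nat -> X -> X -> R) q :
  (forall x y, q_ n x y @[n --> \oo] --> q x y) -> (forall n, psd (q_ n)) ->
  psd q.
Proof.
move=> qq q_P; split=> [x y|v].
  rewrite -(cvg_lim _ (qq x y))// -(cvg_lim _ (qq y x))//.
  by under eq_fun do rewrite (proj1 (q_P _)).
have h : qf (q_ n) v v @[n --> \oo] --> qf q v v.
  by apply: lin_cvg => x; apply: lin_cvg => y; exact: qq.
rewrite -(cvg_lim _ h)//; apply: limr_ge.
  by apply/cvg_ex; exists (qf q v v).
by near=> n; exact: (proj2 (q_P n)).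
Unshelve. all: by end_near. Qed.

(** Removing two Taylor terms lets exp(q) - 1 and exp(q) - q both appear as sums of positive
    kernels; these differences put the constants and the sections into [exp_algebra]. *)
Lemma psd_expR_taylor1 q : psd q -> psd (fun x y => expR (q x y) - (1 + q x y)).
Proof.
(* The shift by 2 makes [q_ 0] the zero kernel; each further term is a Schur power with a positive
   coefficient. *)
move=> qP; pose q_ n x y := series (exp_coeff (q x y)) (n + 2)%N - (1 + q x y).
apply: (@psd_lim q_) => [x y|n].
  apply: cvgB; last exact: cvg_cst.
  have : series (exp_coeff (q x y)) @ \oo --> expR (q x y).
    exact: is_cvg_series_exp_coeff.
  by rewrite -(cvg_shiftn 2).
elim: n => [|n IH].
  apply: psd_ext psd0 => x y.
  rewrite /q_ /series /= !big_nat_recl// big_geq// /exp_coeff /=.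
  by rewrite expr0 expr1 fact0 factS fact0 !divr1 addr0 subrr.
have a0 : 0 <= n.+2`!%:R^-1 :> R by rewrite invr_ge0 ler0n.
apply: psd_ext (psd_lincomb a0 (psdX n.+2 qP) IH) => x y.
rewrite /q_ !addn2 /series /= [X in _ = X - _]big_nat_recr//=.
by rewrite /exp_coeff /=; ring.
Qed.

Lemma psd_expR q : psd q -> psd (fun x y => expR (q x y)).
Proof.
move=> qP; apply: psd_ext (psdD (psd_expR_taylor1 qP) (psdD psd1 qP)) => x y.
by rewrite subrK.
Qed.

End RealPositiveDefinite.

(** Conditional negative definiteness speaks of distinct points, whereas a combination may repeat a
    point; coefficients at equal points are added up. *)
Lemma merge_points (R : realType) (X : choiceType) (v : seq (R * X)) :
  exists (n : nat) (x : 'I_n -> X) (c : 'I_n -> R), injective x /\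
    forall F, lin F v = \sum_(i < n) c i * F (x i).
Proof.
pose s := undup (unzip2 v); have us : uniq s by exact: undup_uniq.
pose x := tnth (in_tuple s).
exists (size s), x, (fun i => \sum_(p <- v | p.2 == x i) p.1); split.
  move=> i j; rewrite /x !(tnth_nth (x i)) /= => /eqP.
  by rewrite nth_uniq// => /eqP; exact: val_inj.
move=> F; transitivity (\sum_(y <- s) \sum_(p <- v | p.2 == y) p.1 * F p.2).
  rewrite (exchange_big_dep xpredT)//= /lin big_seq [RHS]big_seq.
  apply: eq_bigr => p pv; rewrite big_mkcond (bigD1_seq p.2)//=; last first.
    by rewrite mem_undup; apply/mapP; exists p.
  by rewrite eqxx big1 ?addr0// => y; rewrite eq_sym => /negbTE ->.
rewrite big_tnth; apply: eq_bigr => i _; rewrite mulr_suml.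
by apply: eq_bigr => p /eqP ->.
Qed.

Lemma cond_negative_definite_qf (R : realType) (X : choiceType)
    (g : X -> X -> R) (v : seq (R * X)) :
  cond_negative_definite g -> lin (fun=> 1) v = 0 -> qf g v v <= 0.
Proof.
case=> gC gN; have [n [x [c [xI e]]]] := merge_points v; rewrite e => c0.
rewrite /qf e; under eq_bigr do rewrite e mulr_sumr.
under eq_bigr do under eq_bigr do rewrite mulrA.
apply: gN => //; move: c0; under eq_bigr do rewrite mulr1.
by [].
Qed.

(** The bilinear form of -g evaluated at delta_x - delta_z and delta_y - delta_z, two measures of
    total mass zero. *)
Definition centered_kernel {R : realType} {X : Type} (g : X -> X -> R) z x y :=
  g x z + g z y - g x y - g z z.

(** If [v] has mass c, then v - c delta_z has mass zero, and the form of g there is minus the form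
    of the centered kernel at [v]. *)
Lemma centered_kernel_psd (R : realType) (X : choiceType) (g : X -> X -> R) z :
  cond_negative_definite g -> psd (centered_kernel g z).
Proof.
move=> gP; have [gC _] := gP; split=> [x y|v].
  by rewrite /centered_kernel (gC x y) (gC x z) (gC y z); ring.
pose c := lin (fun=> 1) v.
have := @cond_negative_definite_qf _ _ _ ((- c, z) :: v) gP.
rewrite lin_cons -/c /= mulr1 addNr => /(_ erefl); rewrite qf_cons//=.
have -> : qf (centered_kernel g z) v v =
    2 * c * lin (g z) v - qf g v v - c ^+ 2 * g z z; last by nra.
(* An opaque constant function keeps the three terms other than g recognisable as rank-one
   kernels. *)
have [one oneE] : {one : X -> R | forall x, one x = 1} by exists (fun=> 1).
rewrite (@eq_qf _ _ _ (fun x y => 1 * (g z x * one y) + (1 * (one x * g z y) +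
  ((-1) * g x y + (- g z z) * (one x * one y))))); last first.
  by move=> x y; rewrite /centered_kernel !oneE (gC x z); ring.
rewrite !qf_funD qf_funM !qf_rank1 (@eq_lin _ _ one (fun=> 1))// -/c; ring.
Qed.

(** * Domination of functions by kernels *)

Section Domination.
Context {R : realType} {X : Type}.
Implicit Types (p f : X -> R) (q : X -> X -> R).

Definition dominated p q :=
  exists2 C : R, 0 <= C & psd (fun x y => C * q x y - p x * p y).

Lemma dominated_sqr_le p q : dominated p q ->
  exists2 C : R, 0 <= C & forall v, lin p v ^+ 2 <= C * qf q v v.
Proof.
move=> [C C0 [_ h]]; exists C => // v; have := h v.
rewrite (@eq_qf _ _ _ (fun x y => C * q x y + (- 1) * (p x * p y))).
  by rewrite qf_funD qf_funM qf_rank1; lra.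
by move=> x y; ring.
Qed.

Lemma dominated_section q x : psd q -> dominated (q x) q.
Proof.
by move=> qP; exists (q x x); [exact: psd_diag_ge0|exact: psd_schur_complement].
Qed.

Lemma dominated_mono p q1 q2 : psd (fun x y => q2 x y - q1 x y) ->
  dominated p q1 -> dominated p q2.
Proof.
move=> q12 [C C0 h]; exists C => //.
by apply: psd_ext (psd_lincomb C0 q12 h) => x y; ring.
Qed.

Lemma dominatedZ p q a : 0 < a -> dominated p (fun x y => a * q x y) ->
  dominated p q.
Proof.
move=> a0 [C C0 h]; exists (C * a); first by rewrite mulr_ge0// ltW.
by apply: psd_ext h => x y; ring.
Qed.

Lemma dominated_lincomb p1 p2 q a : dominated p1 q -> dominated p2 q ->
  dominated (fun x => a * p1 x + p2 x) q.
Proof.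
move=> [C1 C10 h1] [C2 C20 h2].
have a0 : 0 <= 2 * a ^+ 2 by rewrite mulr_ge0 ?ler0n ?sqr_ge0.
(* The constants come from (a p1 + p2)^2 + (a p1 - p2)^2 = 2 a^2 p1^2 + 2 p2^2; the second square
   contributes a rank-one kernel. *)
exists (2 * a ^+ 2 * C1 + 2 * C2).
  by apply: addr_ge0; apply: mulr_ge0 => //; exact: ler0n.
have h := psd_lincomb (ler0n _ 2) h2 (psd_rank1 (fun x => a * p1 x - p2 x)).
by apply: psd_ext (psd_lincomb a0 h1 h) => x y; ring.
Qed.

Lemma dominatedM p1 p2 q1 q2 : psd q2 -> dominated p1 q1 -> dominated p2 q2 ->
  dominated (fun x => p1 x * p2 x) (fun x y => q1 x y * q2 x y).
Proof.
move=> q2P [C1 C10 h1] [C2 C20 h2]; exists (C1 * C2); first by rewrite mulr_ge0.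
(* Telescoping: with primes for the second variable, C1 C2 q1 q2 - p1 p1' p2 p2' = (C1 q1 - p1 p1')
   C2 q2 + p1 p1' (C2 q2 - p2 p2'). *)
have h := psdD (psdM h1 (psdZ C20 q2P)) (psd_congr p1 h2).
by apply: psd_ext h => x y; ring.
Qed.

Lemma dominated_congr p q f : dominated p q ->
  dominated (fun x => f x * p x) (fun x y => f x * f y * q x y).
Proof.
move=> [C C0 h]; exists C => //.
by apply: psd_ext (psd_congr f h) => x y; ring.
Qed.

End Domination.

Section ExpAlgebra.
Context {R : realType} {X : Type}.
Variable k : X -> X -> R.
Hypothesis kP : psd k.
Implicit Types (p : X -> R).

Let exp_kernel (e : R) x y := expR (e * k x y).

(* Quantifying over all exponents makes the set closed under products, as
   exp(e k) = exp(e k / 2) ^ 2; only the exponent 1 matters in the end. *)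
Definition exp_algebra : set (X -> R) :=
  [set p | forall e : R, 0 < e -> dominated p (exp_kernel e)].

Let expP (e : R) : 0 < e -> psd (exp_kernel e).
Proof. by move=> e0; apply: psd_expR; apply: psdZ; first exact: ltW. Qed.

Lemma exp_algebra1 : exp_algebra (fun=> 1).
Proof.
move=> e e0; exists 1 => //; have kP' := psdZ (ltW e0) kP.
apply: psd_ext (psdD (psd_expR_taylor1 kP') kP') => x y.
by rewrite /exp_kernel; ring.
Qed.

Lemma exp_algebra_section x : exp_algebra (k x).
Proof.
move=> e e0; have kP' := psdZ (ltW e0) kP.
apply: (@dominated_mono _ _ _ (fun y z => e * k y z)).
  apply: psd_ext (psdD (psd_expR_taylor1 kP') psd1) => y z.
  by rewrite /exp_kernel; ring.
apply: (dominatedZ (a := e^-1)); first by rewrite invr_gt0.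
have [C C0 h] := dominated_section x kP; exists C => //.
by apply: psd_ext h => y z /=; rewrite mulKf// gt_eqF.
Qed.

Lemma exp_algebra_lincomb a p1 p2 : exp_algebra p1 -> exp_algebra p2 ->
  exp_algebra (fun x => a * p1 x + p2 x).
Proof.
by move=> h1 h2 e e0; apply: dominated_lincomb; [exact: h1|exact: h2].
Qed.

Lemma exp_algebraM p1 p2 : exp_algebra p1 -> exp_algebra p2 ->
  exp_algebra (fun x => p1 x * p2 x).
Proof.
move=> h1 h2 e e0; have e20 : 0 < e / 2 by rewrite divr_gt0.
have [C C0 h] := dominatedM (expP e20) (h1 _ e20) (h2 _ e20); exists C => //.
by apply: psd_ext h => x y; rewrite /exp_kernel -expRD -mulrDl -splitr.
Qed.

Lemma exp_algebra_dominated p : exp_algebra p ->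
  dominated p (fun x y => expR (k x y)).
Proof.
move=> /(_ 1 ltr01) [C C0 h]; exists C => //.
by apply: psd_ext h => x y; rewrite /exp_kernel mul1r.
Qed.

End ExpAlgebra.

(** * Reproducing kernel Hilbert spaces *)

Section RealRKHS.
Context {R : realType} {X : Type}.
Variable q : X -> X -> R.
Hypothesis qP : psd q.
Implicit Types (F G E : X -> R) (u v w : seq (R * X)).

Let qC x y : q x y = q y x. Proof. exact: (proj1 qP). Qed.
Let q0 v : 0 <= qf q v v. Proof. exact: (proj2 qP). Qed.

Definition comb w : X -> R := fun x => lin (q x) w.

(** The functions that act boundedly on finite combinations under the seminorm [qf q], that is, the
    dual description of the reproducing kernel Hilbert space. *)
Definition rk_mem F :=
  exists2 C : R, 0 <= C & forall v, lin F v ^+ 2 <= C * qf q v v.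

Definition rk_energy F v := 2 * lin F v - qf q v v.

(* The Legendre transform of the energy: this is the squared norm of F as a
   functional on the span of the kernel sections. *)
Definition rk_norm2 F : R := sup [set rk_energy F v | v in setT].

Definition rk_dist2 F w := rk_norm2 (fun x => F x - comb w x).

Lemma lin_comb v w : lin (comb w) v = qf q v w.
Proof. by []. Qed.

Lemma rk_energy_ub F : rk_mem F ->
  has_ubound [set rk_energy F v | v in setT].
Proof.
move=> [C C0 h]; exists C => _ [v _ <-].
by rewrite /rk_energy lerBlDr; exact: sqr_le_mul.
Qed.

Lemma rk_energy_le F v : rk_mem F -> rk_energy F v <= rk_norm2 F.
Proof. by move=> /rk_energy_ub Fub; apply: ub_le_sup => //; exists v. Qed.

Lemma rk_norm2_le F C : (forall v, rk_energy F v <= C) -> rk_norm2 F <= C.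
Proof.
move=> h; apply: ge_sup => [|_ [v _ <-]]; last exact: h.
by exists (rk_energy F [::]), [::].
Qed.

Lemma rk_energy_nil F : rk_energy F [::] = 0.
Proof. by rewrite /rk_energy /qf !lin_nil mulr0 subr0. Qed.

Lemma rk_norm2_ge0 F : rk_mem F -> 0 <= rk_norm2 F.
Proof. by move=> /(rk_energy_le [::]); rewrite rk_energy_nil. Qed.

(** The hypothesis at all multiples t v bounds a quadratic polynomial in t; its discriminant
    recovers Cauchy-Schwarz from the sum form. *)
Lemma rk_energy_bound F C v : (forall v, rk_energy F v <= C) ->
  lin F v ^+ 2 <= C * qf q v v.
Proof.
move=> h; rewrite mulrC; apply: discriminant_le => // t.
have := h (scale_comb t v).
by rewrite /rk_energy lin_scale qf_scalel qf_scaler; nra.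
Qed.

Lemma rk_memI F C : (forall v, rk_energy F v <= C) -> rk_mem F.
Proof.
move=> h; exists C => [|v]; last exact: rk_energy_bound.
by rewrite -(rk_energy_nil F).
Qed.

Lemma rk_cauchy_schwarz F v : rk_mem F ->
  lin F v ^+ 2 <= rk_norm2 F * qf q v v.
Proof. by move=> FH; apply: rk_energy_bound => u; exact: rk_energy_le. Qed.

(** No inner product is at hand yet, so this replaces the triangle inequality: half of [qf q v v] is
    spent on each summand, which produces the factors 2. *)
Lemma rk_energy_lincomb a F G v : rk_mem F -> rk_mem G ->
  rk_energy (fun x => a * F x + G x) v <=
  2 * a ^+ 2 * rk_norm2 F + 2 * rk_norm2 G.
Proof.
move=> FH GH; rewrite /rk_energy lin_funD.
have hF := rk_cauchy_schwarz v FH; have hG := rk_cauchy_schwarz v GH.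
have F0 := rk_norm2_ge0 FH; have G0 := rk_norm2_ge0 GH.
have v0 : 0 <= qf q v v / 2 by rewrite divr_ge0.
have aF : 0 <= 2 * (a ^+ 2 * rk_norm2 F).
  by apply: mulr_ge0 => //; apply: mulr_ge0 => //; exact: sqr_ge0.
have h1 : (a * lin F v) ^+ 2 <= 2 * (a ^+ 2 * rk_norm2 F) * (qf q v v / 2).
  by have := sqr_ge0 a; nra.
have h2 : (lin G v) ^+ 2 <= 2 * rk_norm2 G * (qf q v v / 2) by nra.
have := sqr_le_mul aF v0 h1.
have := sqr_le_mul (mulr_ge0 (ler0n _ 2) G0) v0 h2.
lra.
Qed.

Lemma rk_mem_lincomb a F G : rk_mem F -> rk_mem G ->
  rk_mem (fun x => a * F x + G x).
Proof. by move=> FH GH; apply: rk_memI => v; exact: rk_energy_lincomb. Qed.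

Lemma rk_norm2_lincomb a F G : rk_mem F -> rk_mem G ->
  rk_norm2 (fun x => a * F x + G x) <=
  2 * a ^+ 2 * rk_norm2 F + 2 * rk_norm2 G.
Proof. by move=> FH GH; apply: rk_norm2_le => v; exact: rk_energy_lincomb. Qed.

Lemma rk_mem0 : rk_mem (fun=> 0).
Proof. by exists 0 => // v; rewrite lin0 expr0n mul0r. Qed.

Lemma rk_memB F G : rk_mem F -> rk_mem G -> rk_mem (fun x => F x - G x).
Proof.
move=> FH GH; have := rk_mem_lincomb (-1) GH FH.
by congr rk_mem; apply/funext => x; rewrite mulN1r addrC.
Qed.

Lemma rk_norm2B F G : rk_mem F -> rk_mem G ->
  rk_norm2 (fun x => F x - G x) <= 2 * rk_norm2 F + 2 * rk_norm2 G.
Proof.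
move=> FH GH; have := rk_norm2_lincomb (-1) GH FH.
rewrite sqrrN expr1n mulr1 addrC; apply: le_trans.
by rewrite le_eqVlt (_ : (fun x => F x - G x) = (fun x => -1 * G x + F x))
  ?eqxx//; apply/funext => x; rewrite mulN1r addrC.
Qed.

Lemma rk_energy_comb w v : rk_energy (comb w) v <= qf q w w.
Proof.
have := q0 (v ++ scale_comb (-1) w).
rewrite !(qf_catl, qf_catr, qf_scalel, qf_scaler) /rk_energy lin_comb.
by rewrite (qf_sym w v qC); lra.
Qed.

Lemma rk_mem_comb w : rk_mem (comb w).
Proof. by apply: rk_memI => v; exact: rk_energy_comb. Qed.

Lemma rk_norm2_comb w : rk_norm2 (comb w) = qf q w w.
Proof.
apply/le_anti/andP; split; first by apply: rk_norm2_le; exact: rk_energy_comb.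
have := rk_energy_le w (rk_mem_comb w).
by rewrite /rk_energy lin_comb; lra.
Qed.

Lemma rk_mem_section x : rk_mem (q x).
Proof.
have := rk_mem_comb [:: (1, x)]; congr rk_mem; apply/funext => y.
by rewrite /comb lin_cons lin_nil mul1r addr0 qC.
Qed.

Lemma rk_memBcomb F w : rk_mem F -> rk_mem (fun x => F x - comb w x).
Proof. by move=> FH; apply: rk_memB => //; exact: rk_mem_comb. Qed.

Lemma rk_dist2_ge0 F w : rk_mem F -> 0 <= rk_dist2 F w.
Proof. by move=> FH; apply: rk_norm2_ge0; exact: rk_memBcomb. Qed.

(* Completing the square: the energy of F - comb w at v is that of F at v ++ w
   minus that of F at w. *)
Lemma rk_dist2_le F w : rk_mem F -> rk_dist2 F w <= rk_norm2 F - rk_energy F w.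
Proof.
move=> FH; apply: rk_norm2_le => v; have := rk_energy_le (v ++ w) FH.
rewrite /rk_energy lin_cat !(qf_catl, qf_catr) (qf_sym w v qC).
rewrite (@eq_lin _ _ (fun x => F x - _) (fun x => -1 * comb w x + F x)).
  by rewrite lin_funD lin_comb; lra.
by move=> x; rewrite mulN1r addrC.
Qed.

(** A near-maximiser of the energy is a good approximation, by completing the square. The bound on
    the energy gap is kept because [rk_ipxx] compares the inner product with the energy. *)
Lemma rk_approx F (e : R) : rk_mem F -> 0 < e ->
  exists2 w, rk_dist2 F w <= e & rk_norm2 F - rk_energy F w <= e.
Proof.
move=> FH e0.
have FS : has_sup [set rk_energy F v | v in setT].
  by split; [exists (rk_energy F [::]), [::]|exact: rk_energy_ub].
have [_ [w _ <-] h] := sup_adherent e0 FS.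
have {}h : rk_norm2 F - rk_energy F w <= e.
  by move: h; rewrite /rk_norm2 ltrBlDl -ltrBlDr => /ltW; rewrite addrC.
by exists w => //; apply: le_trans h; exact: rk_dist2_le.
Qed.

(** The combination w1 - w2 is the difference of the two errors G - w2 and G - w1, so the values of
    F on combinations converging to G are Cauchy. *)
Lemma rk_lin_diff F G w1 w2 : rk_mem F -> rk_mem G ->
  (lin F w1 - lin F w2) ^+ 2 <=
  rk_norm2 F * (2 * rk_dist2 G w1 + 2 * rk_dist2 G w2).
Proof.
move=> FH GH; pose u := w1 ++ scale_comb (-1) w2.
have -> : lin F w1 - lin F w2 = lin F u by rewrite lin_cat lin_scale mulN1r.
apply: le_trans (rk_cauchy_schwarz u FH) _.
rewrite ler_wpM2l ?rk_norm2_ge0// -rk_norm2_comb addrC.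
apply: le_trans (rk_norm2B (rk_memBcomb w2 GH) (rk_memBcomb w1 GH)).
rewrite le_eqVlt (_ : comb u = (fun x => G x - comb w2 x - (G x - comb w1 x))).
  by rewrite eqxx.
by apply/funext => x; rewrite /comb lin_cat lin_scale; ring.
Qed.

(** The intervals with centre [lin F w] and radius [r w] meet pairwise, because the squared distance
    of two centres is at most the sum of the squared radii. The supremum of the left ends then lies
    in all of them. *)
Lemma rk_ip_ex F G : rk_mem F -> rk_mem G ->
  exists z : R, forall w,
    (z - lin F w) ^+ 2 <= 2 * rk_norm2 F * rk_dist2 G w.
Proof.
move=> FH GH; pose B w := 2 * rk_norm2 F * rk_dist2 G w.
have B0 w : 0 <= B w.
  apply: mulr_ge0; last exact: rk_dist2_ge0.
  by apply: mulr_ge0 => //; exact: rk_norm2_ge0.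
pose r w := Num.sqrt (B w).
have r2 w : r w ^+ 2 = B w by rewrite sqr_sqrtr.
have r0 w : 0 <= r w by exact: sqrtr_ge0.
have cross w1 w2 : lin F w1 - r w1 <= lin F w2 + r w2.
  have := rk_lin_diff w1 w2 FH GH.
  have -> : rk_norm2 F * (2 * rk_dist2 G w1 + 2 * rk_dist2 G w2) =
    r w1 ^+ 2 + r w2 ^+ 2 by rewrite !r2 /B; ring.
  move=> h; rewrite leNgt; apply/negP => hlt.
  by have := r0 w1; have := r0 w2; nra.
pose S := [set lin F w - r w | w in setT].
have Sub w : ubound S (lin F w + r w) by move=> _ [w' _ <-].
exists (sup S) => w; rewrite -/(B w) -r2.
have h1 : lin F w - r w <= sup S.
  by apply: ub_le_sup; [exists (lin F [::] + r [::])|exists w].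
have h2 : sup S <= lin F w + r w.
  by apply: ge_sup => //; exists (lin F [::] - r [::]), [::].
by have := r0 w; nra.
Qed.

(* Since combinations come arbitrarily close to G, at most one z satisfies all
   these estimates; this avoids taking a limit along a sequence. *)
Definition rk_ip F G : R :=
  xget 0 [set z | forall w, (z - lin F w) ^+ 2 <= 2 * rk_norm2 F * rk_dist2 G w].

Lemma rk_ip_near F G w : rk_mem F -> rk_mem G ->
  (rk_ip F G - lin F w) ^+ 2 <= 2 * rk_norm2 F * rk_dist2 G w.
Proof.
move=> FH GH; rewrite /rk_ip.
by have := xgetPex 0 (rk_ip_ex FH GH) => /(_ w).
Qed.

(** The tool for computing inner products: since any multiple [M] is allowed, an identity may be
    checked with crude constants. *)
Lemma rk_ip_unique F G (z M : R) : rk_mem F -> rk_mem G ->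
  (forall w, (z - lin F w) ^+ 2 <= M * rk_dist2 G w) -> rk_ip F G = z.
Proof.
move=> FH GH h; apply/eqP; rewrite -subr_eq0 -sqrf_eq0 eq_le sqr_ge0 andbT.
have F0 := rk_norm2_ge0 FH.
(* Twice the sum of the two coefficients [M] and [2 * rk_norm2 F], as (s + t)^2 <= 2 s^2 + 2 t^2;
   the 1 keeps the divisor positive. *)
pose K := 2 * `|M| + 4 * rk_norm2 F + 1.
have K0 : 0 < K by rewrite /K; have := normr_ge0 M; lra.
apply/ler_addgt0Pr => e e0; rewrite add0r.
have [w dw _] := rk_approx GH (divr_gt0 e0 K0).
have h1 := h w; have h2 := rk_ip_near w FH GH; have d0 := rk_dist2_ge0 w GH.
have : K * rk_dist2 G w <= e by rewrite -ler_pdivlMl// mulrC.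
have : M * rk_dist2 G w <= `|M| * rk_dist2 G w.
  by rewrite ler_wpM2r// ler_norm.
by rewrite /K; have := sqr_ge0 (rk_ip F G + z - 2 * lin F w); nra.
Qed.

Lemma rk_ip_lincomb a F G E : rk_mem F -> rk_mem G -> rk_mem E ->
  rk_ip (fun x => a * F x + G x) E = a * rk_ip F E + rk_ip G E.
Proof.
move=> FH GH EH.
apply: (@rk_ip_unique _ _ _ (4 * a ^+ 2 * rk_norm2 F + 4 * rk_norm2 G)) => //.
  exact: rk_mem_lincomb.
move=> w; rewrite lin_funD; have d0 := rk_dist2_ge0 w EH.
have hF := rk_ip_near w FH EH; have hG := rk_ip_near w GH EH.
have : a ^+ 2 * (rk_ip F E - lin F w) ^+ 2 <=
       a ^+ 2 * (2 * rk_norm2 F * rk_dist2 E w) by rewrite ler_wpM2l// sqr_ge0.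
have := sqr_ge0 (a * (rk_ip F E - lin F w) - (rk_ip G E - lin G w)); nra.
Qed.

Lemma rk_dist2_comb w : rk_dist2 (comb w) w = 0.
Proof.
rewrite /rk_dist2 (_ : (fun x => _) = comb [::]).
  by rewrite rk_norm2_comb /qf lin_nil.
by apply/funext => x; rewrite subrr /comb lin_nil.
Qed.

Lemma rk_ip_comb F w : rk_mem F -> rk_ip F (comb w) = lin F w.
Proof.
move=> FH; have := rk_ip_near w FH (rk_mem_comb w).
rewrite rk_dist2_comb mulr0 => h; apply/eqP.
by rewrite -subr_eq0 -sqrf_eq0 eq_le h sqr_ge0.
Qed.

Lemma rk_ip_combl F w : rk_mem F -> rk_ip (comb w) F = lin F w.
Proof.
move=> FH; apply: (@rk_ip_unique _ _ _ (qf q w w)) => //.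
  exact: rk_mem_comb.
move=> u; rewrite lin_comb (qf_sym _ _ qC) -lin_comb mulrC.
have := rk_cauchy_schwarz w (rk_memBcomb u FH).
rewrite (@eq_lin _ _ (fun x => F x - _) (fun x => -1 * comb u x + F x)).
  by rewrite lin_funD mulN1r addrC [leRHS]mulrC mulrC.
by move=> x; rewrite mulN1r addrC.
Qed.

(** The defining estimate at the empty combination. The factor 2 is inherited from it and is
    harmless where only smallness matters. *)
Lemma rk_ip_sqr_le F G : rk_mem F -> rk_mem G ->
  rk_ip F G ^+ 2 <= 2 * rk_norm2 F * rk_norm2 G.
Proof.
move=> FH GH; have := rk_ip_near [::] FH GH; rewrite lin_nil subr0.
rewrite /rk_dist2 (_ : (fun x => _) = G)//.
by apply/funext => x; rewrite /comb lin_nil subr0.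
Qed.

Lemma rk_ipBcomb F G w : rk_mem F -> rk_mem G ->
  rk_ip (fun x => F x - comb w x) G = rk_ip F G - lin G w.
Proof.
move=> FH GH; rewrite -rk_ip_combl//.
have := rk_ip_lincomb (-1) (rk_mem_comb w) FH GH.
rewrite mulN1r addrC => <-; congr (rk_ip _ _).
by apply/funext => x; rewrite mulN1r addrC.
Qed.

Lemma rk_ipC F G : rk_mem F -> rk_mem G -> rk_ip F G = rk_ip G F.
Proof.
move=> FH GH; apply: (@rk_ip_unique _ _ _ (2 * rk_norm2 F)) => // w.
rewrite -(rk_ipBcomb _ GH FH) -mulrA (mulrC (rk_norm2 F)) mulrA.
by apply: rk_ip_sqr_le => //; exact: rk_memBcomb.
Qed.

Lemma rk_ipxx F : rk_mem F -> rk_ip F F = rk_norm2 F.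
Proof.
move=> FH; apply/eqP; rewrite -subr_eq0 -normr_le0.
apply/ler_addgt0Pr => e e0; rewrite add0r.
(* The inner product lies within sqrt(2) e/3 of the energy at [w], and the energy within e/3 of the
   squared norm; together this is less than e. *)
have [w d1 d2] := rk_approx FH (divr_gt0 e0 (ltr0n R 3)).
have DH := rk_memBcomb w FH; have d0 := rk_dist2_ge0 w FH.
have h := rk_ip_sqr_le DH DH; rewrite -/(rk_dist2 F w) in h.
have E : rk_ip (fun x => F x - comb w x) (fun x => F x - comb w x) =
    rk_ip F F - rk_energy F w.
  rewrite rk_ipBcomb// rk_ipC// rk_ipBcomb// /rk_energy.
  rewrite (@eq_lin _ _ (fun x => F x - _) (fun x => -1 * comb w x + F x)).
    by rewrite lin_funD lin_comb; ring.
  by move=> x; rewrite mulN1r addrC.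
rewrite E in h.
have l : 0 <= rk_norm2 F - rk_energy F w by rewrite subr_ge0 rk_energy_le.
by rewrite ler_norml; apply/andP; split; nra.
Qed.

Lemma rk_reproducing F x : rk_mem F -> rk_ip F (q x) = F x.
Proof.
move=> FH; have := rk_ip_comb [:: (1, x)] FH.
rewrite lin_cons lin_nil mul1r addr0 => <-; congr (rk_ip _ _).
by apply/funext => y; rewrite /comb lin_cons lin_nil mul1r addr0 qC.
Qed.

Lemma rk_eval_le F x : rk_mem F -> F x ^+ 2 <= rk_norm2 F * q x x.
Proof.
move=> /(rk_cauchy_schwarz [:: (1, x)]).
by rewrite /qf !lin_cons !lin_nil !mul1r !addr0.
Qed.

(** Cauchy-Schwarz at delta_x - delta_y; it transfers continuity of the kernel to every member of
    the space. *)
Lemma rk_oscillation_le F x y : rk_mem F ->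
  (F x - F y) ^+ 2 <= rk_norm2 F * (q x x + q y y - 2 * q x y).
Proof.
move=> /(rk_cauchy_schwarz [:: (1, x); (-1, y)]).
rewrite /qf !lin_cons !lin_nil /= (qC y x).
by congr (_ <= _); ring.
Qed.

Lemma rk_norm2_eq0 F : rk_mem F -> rk_norm2 F = 0 -> F = fun=> 0.
Proof.
move=> FH F0; apply/funext => x; have := rk_eval_le x FH.
rewrite F0 mul0r => h; apply/eqP.
by rewrite -sqrf_eq0 eq_le h sqr_ge0.
Qed.

(** Evaluations are bounded, so a Cauchy sequence converges pointwise. For fixed [v] the energy
    passes to this limit, and bounds uniform in [v] survive the supremum. *)
Lemma rk_complete (u : nat -> X -> R) : (forall n, rk_mem (u n)) ->
  (forall e : R, 0 < e -> exists N, forall m n, (N <= m)%N -> (N <= n)%N ->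
     rk_norm2 (fun x => u m x - u n x) <= e) ->
  exists2 F, rk_mem F & forall e : R, 0 < e -> exists N, forall n, (N <= n)%N ->
     rk_norm2 (fun x => u n x - F x) <= e.
Proof.
move=> uH uC.
have ux x : cvgn (u ^~ x).
  apply/cauchy_cvgP/cauchy_exP => e e0.
  have K0 : 0 < q x x + 1 by rewrite ltr_pwDr// psd_diag_ge0.
  have [N hN] := uC _ (divr_gt0 (exprn_gt0 2 e0) (mulr_gt0 (ltr0n R 2) K0)).
  exists (u N x); exists N => // n /= Nn.
  rewrite /ball /= -(@ltr_pXn2r _ 2) ?nnegrE// ?(ltW e0)//.
  rewrite real_normK ?num_real//.
  have := rk_eval_le x (rk_memB (uH N) (uH n)) => /le_lt_trans; apply.
  have := hN N n (leqnn _) Nn; have := rk_norm2_ge0 (rk_memB (uH N) (uH n)).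
  set D := rk_norm2 _ => D0; rewrite ler_pdivlMr; last by rewrite mulr_gt0.
  have : 0 < e ^+ 2 by rewrite exprn_gt0.
  by have := psd_diag_ge0 x qP; nra.
pose F x := limn (u ^~ x).
have uF x : u n x @[n --> \oo] --> F x by exact: ux.
have key (e : R) : 0 < e -> exists N, forall n, (N <= n)%N ->
    forall v, rk_energy (fun x => u n x - F x) v <= e.
  move=> e0; have [N hN] := uC e e0; exists N => n Nn v.
  rewrite /rk_energy; set E := (leLHS).
  have h : (2 * lin (fun x => u n x - u m x) v - qf q v v) @[m --> \oo] --> E.
    apply: cvgB; last exact: cvg_cst.
    apply: cvgM; first exact: cvg_cst.
    by apply: lin_cvg => x; apply: cvgB => //; exact: cvg_cst.
  rewrite -(cvg_lim _ h)//; apply: limr_le; first by apply/cvg_ex; exists E.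
  near=> m; apply: le_trans (hN n m _ _) => //; last first.
    by near: m; exact: nbhs_infty_ge.
  by apply: rk_energy_le; exact: rk_memB.
have [N0 h0] := key 1 ltr01.
exists F.
  have := rk_memB (uH N0) (rk_memI (h0 _ (leqnn _))).
  by congr rk_mem; apply/funext => x; rewrite opprB addrC subrK.
by move=> e /key[N hN]; exists N => n /hN h; exact: rk_norm2_le.
Unshelve. all: by end_near. Qed.

End RealRKHS.

(** * Complexification of the real space *)

Section ComplexRKHS.
Context {R : realType} {X : Type}.
Variable q : X -> X -> R.
Hypothesis qP : psd q.
Local Notation C := (cplx R).
Local Notation K := (to_complex q).
Implicit Types (F G E : X -> C).

Definition re_fun F : X -> R := fun x => complex.Re (F x).
Definition im_fun F : X -> R := fun x => complex.Im (F x).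

Definition crk_mem : set (X -> C) :=
  [set F | rk_mem q (re_fun F) /\ rk_mem q (im_fun F)].

Definition crk_ip F G : C :=
  Complex (rk_ip q (re_fun F) (re_fun G) + rk_ip q (im_fun F) (im_fun G))
          (rk_ip q (im_fun F) (re_fun G) - rk_ip q (re_fun F) (im_fun G)).

Lemma conj_complex (a b : R) : Num.conj (Complex a b : C) = Complex a (- b).
Proof. by []. Qed.

Lemma re_fun_lincomb (a : C) F G : re_fun (a *: F + G) =
  fun x => complex.Re a * re_fun F x + (- complex.Im a * im_fun F x + re_fun G x).
Proof.
apply/funext => x; rewrite /re_fun /im_fun.
change ((a *: F + G) x) with (a * F x + G x).
case: a (F x) (G x) => [a b] [c d] [e f] /=; ring.
Qed.

Lemma im_fun_lincomb (a : C) F G : im_fun (a *: F + G) =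
  fun x => complex.Re a * im_fun F x + (complex.Im a * re_fun F x + im_fun G x).
Proof.
apply/funext => x; rewrite /re_fun /im_fun.
change ((a *: F + G) x) with (a * F x + G x).
case: a (F x) (G x) => [a b] [c d] [e f] /=; ring.
Qed.

Lemma re_funB F G : re_fun (F - G) = fun x => re_fun F x - re_fun G x.
Proof.
apply/funext => x; rewrite /re_fun; change ((F - G) x) with (F x - G x).
by case: (F x) (G x) => [a b] [c d].
Qed.

Lemma im_funB F G : im_fun (F - G) = fun x => im_fun F x - im_fun G x.
Proof.
apply/funext => x; rewrite /im_fun; change ((F - G) x) with (F x - G x).
by case: (F x) (G x) => [a b] [c d].
Qed.

Lemma crk_memB F G : crk_mem F -> crk_mem G -> crk_mem (F - G).
Proof.
move=> [F1 F2] [G1 G2]; rewrite /crk_mem /= re_funB im_funB.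
by split; exact: rk_memB.
Qed.

Lemma crk_norm F : crk_mem F ->
  ip_norm crk_ip F = Num.sqrt (rk_norm2 q (re_fun F) + rk_norm2 q (im_fun F)).
Proof. by move=> [F1 F2]; rewrite /ip_norm /crk_ip /= !rk_ipxx. Qed.

Lemma crk_norm_lt F (e : R) : crk_mem F -> 0 < e ->
  rk_norm2 q (re_fun F) <= e ^+ 2 / 4 -> rk_norm2 q (im_fun F) <= e ^+ 2 / 4 ->
  ip_norm crk_ip F < e.
Proof.
move=> FH e0 h1 h2; rewrite crk_norm//.
rewrite -(ger0_norm (ltW e0)) -sqrtr_sqr ltr_sqrt ?exprn_gt0//.
have : 0 < e ^+ 2 by rewrite exprn_gt0.
lra.
Qed.

Lemma crk_hilbert : hilbert_function_space crk_mem crk_ip.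
Proof.
split.
- by split; exact: rk_mem0.
- move=> a F G [F1 F2] [G1 G2]; rewrite /crk_mem /= re_fun_lincomb im_fun_lincomb.
  by split; do 2!apply: rk_mem_lincomb => //.
- move=> a F G E [F1 F2] [G1 G2] [E1 E2]; rewrite /crk_ip.
  rewrite re_fun_lincomb im_fun_lincomb !(rk_ip_lincomb qP)//; try exact: rk_mem_lincomb.
  by case: a => a b /=; apply/eqP; rewrite eq_complex /=; apply/andP; split;
    apply/eqP; ring.
- move=> F G [F1 F2] [G1 G2]; rewrite /crk_ip conj_complex.
  rewrite (rk_ipC qP G1 F1) (rk_ipC qP G2 F2) (rk_ipC qP G1 F2) (rk_ipC qP G2 F1).
  by rewrite opprB.
- move=> F [F1 F2]; rewrite /crk_ip (rk_ipC qP F2 F1) subrr.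
  by rewrite (ler0c (_ + _)) !rk_ipxx// addr_ge0// rk_norm2_ge0.
- move=> F [F1 F2]; rewrite /crk_ip !rk_ipxx// => -[h _].
  have N1 := rk_norm2_ge0 qP F1; have N2 := rk_norm2_ge0 qP F2.
  have e1 : re_fun F = fun=> 0 by apply: (rk_norm2_eq0 qP F1); lra.
  have e2 : im_fun F = fun=> 0 by apply: (rk_norm2_eq0 qP F2); lra.
  apply/funext => x; have := congr1 (@^~ x) e1; have := congr1 (@^~ x) e2.
  by rewrite /re_fun /im_fun; case: (F x) => a b /= -> ->.
- move=> u uH uC.
  have uC' (e : R) : 0 < e -> exists N, forall m n, (N <= m)%N -> (N <= n)%N ->
      rk_norm2 q (re_fun (u m - u n)) + rk_norm2 q (im_fun (u m - u n)) <= e.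
    move=> e0; have [|N hN] := uC (Num.sqrt e); first by rewrite sqrtr_gt0.
    exists N => m n Nm Nn; have := hN m n Nm Nn.
    have dH := crk_memB (uH m) (uH n).
    by rewrite crk_norm// ltr_sqrt// => /ltW.
  have N0 m n := conj (rk_norm2_ge0 qP (crk_memB (uH m) (uH n)).1)
                      (rk_norm2_ge0 qP (crk_memB (uH m) (uH n)).2).
  have [F1 F1H c1] : exists2 F1, rk_mem q F1 & forall e : R, 0 < e ->
      exists N, forall n, (N <= n)%N ->
        rk_norm2 q (fun x => re_fun (u n) x - F1 x) <= e.
    apply: rk_complete => // [n|e /uC'[N hN]]; first by case: (uH n).
    exists N => m n Nm Nn; rewrite -re_funB; have [_ ?] := N0 m n.
    by apply: le_trans (hN m n Nm Nn); rewrite lerDl.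
  have [F2 F2H c2] : exists2 F2, rk_mem q F2 & forall e : R, 0 < e ->
      exists N, forall n, (N <= n)%N ->
        rk_norm2 q (fun x => im_fun (u n) x - F2 x) <= e.
    apply: rk_complete => // [n|e /uC'[N hN]]; first by case: (uH n).
    exists N => m n Nm Nn; rewrite -im_funB; have [? _] := N0 m n.
    by apply: le_trans (hN m n Nm Nn); rewrite lerDr.
  pose F : X -> C := fun x => Complex (F1 x) (F2 x).
  have FH : crk_mem F by [].
  exists F => //; apply/cvgr0Pnorm_lt => e e0.
  have e40 : 0 < e ^+ 2 / 4 by rewrite divr_gt0// exprn_gt0.
  have [M1 h1] := c1 _ e40; have [M2 h2] := c2 _ e40.
  near=> n; rewrite ger0_norm ?sqrtr_ge0//.
  apply: crk_norm_lt => //; first exact: crk_memB.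
  + by rewrite re_funB; apply: h1; near: n; exact: nbhs_infty_ge.
  + by rewrite im_funB; apply: h2; near: n; exact: nbhs_infty_ge.
Unshelve. all: by end_near. Qed.

Lemma re_fun_section y : re_fun (kernel_section K y) = q y.
Proof. by apply/funext => x; rewrite /re_fun /= (proj1 qP). Qed.

Lemma im_fun_section y : im_fun (kernel_section K y) = fun=> 0.
Proof. by []. Qed.

Lemma kernel_span_seq (s : seq (C * X)) :
  kernel_span K (\sum_(p <- s) p.1 *: kernel_section K p.2).
Proof.
exists (size s), (fun i => (tnth (in_tuple s) i).1),
  (fun i => (tnth (in_tuple s) i).2).
exact: big_tnth.
Qed.

Lemma kernel_span_comb (w1 w2 : seq (R * X)) :
  kernel_span K (fun x => Complex (comb q w1 x) (comb q w2 x)).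
Proof.
pose s := [seq ((Complex p.1 0 : C), p.2) | p <- w1] ++
          [seq ((Complex 0 p.1 : C), p.2) | p <- w2].
have := kernel_span_seq s; congr kernel_span; apply/funext => x.
rewrite fct_sumE big_cat !big_map /=.
have e1 : \sum_(p <- w1) ((Complex p.1 0 : C) *: kernel_section K p.2) x =
    Complex (comb q w1 x) 0.
  elim: w1 {s} => [|p w IH]; first by rewrite big_nil /comb lin_nil.
  rewrite big_cons IH /comb lin_cons.
  change (((Complex p.1 0 : C) *: kernel_section K p.2) x)
    with ((Complex p.1 0 : C) * Complex (q x p.2) 0).
  by apply/eqP; rewrite eq_complex /=; apply/andP; split; apply/eqP; ring.
have e2 : \sum_(p <- w2) ((Complex 0 p.1 : C) *: kernel_section K p.2) x =
    Complex 0 (comb q w2 x).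
  elim: w2 {s} => [|p w IH]; first by rewrite big_nil /comb lin_nil.
  rewrite big_cons IH /comb lin_cons.
  change (((Complex 0 p.1 : C) *: kernel_section K p.2) x)
    with ((Complex 0 p.1 : C) * Complex (q x p.2) 0).
  by apply/eqP; rewrite eq_complex /=; apply/andP; split; apply/eqP; ring.
by rewrite e1 e2; apply/eqP; rewrite eq_complex /= addr0 add0r !eqxx.
Qed.

Lemma crk_is_rkhs : is_rkhs K crk_mem crk_ip.
Proof.
split; first exact: crk_hilbert.
- move=> y; rewrite /crk_mem /= re_fun_section im_fun_section; split.
    exact: rk_mem_section.
  exact: rk_mem0.
- move=> F y [F1 F2]; rewrite /crk_ip re_fun_section im_fun_section.
  rewrite !(rk_reproducing qP)//.
  have z (f : X -> R) : rk_mem q f -> rk_ip q f (fun=> 0) = 0.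
    move=> fH; have := rk_ip_comb qP [::] fH; rewrite lin_nil => h.
    rewrite -[RHS]h.
    by congr (rk_ip q _ _); apply/funext => x; rewrite /comb lin_nil.
  by rewrite !z// addr0 subr0 /re_fun /im_fun; case: (F y).
- move=> F [F1 F2] e e0.
  have e40 : 0 < e ^+ 2 / 4 by rewrite divr_gt0// exprn_gt0.
  have [w1 d1 _] := rk_approx qP F1 e40; have [w2 d2 _] := rk_approx qP F2 e40.
  exists (fun x => Complex (comb q w1 x) (comb q w2 x)).
    exact: kernel_span_comb.
  apply: crk_norm_lt => //; last 2 first.
  + by rewrite re_funB.
  + by rewrite im_funB.
  + by apply: crk_memB => //; split; exact: rk_mem_comb.
Qed.

Definition family_comb n (a : 'I_n -> R) (x : 'I_n -> X) : seq (R * X) :=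
  [seq (a i, x i) | i <- enum 'I_n].

Lemma lin_family n (a : 'I_n -> R) (x : 'I_n -> X) (f : X -> R) :
  lin f (family_comb a x) = \sum_(i < n) a i * f (x i).
Proof. by rewrite /lin big_map big_enum. Qed.

Lemma sum_complex (I : Type) (r : seq I) (f g : I -> R) :
  \sum_(i <- r) (Complex (f i) (g i) : C) =
  Complex (\sum_(i <- r) f i) (\sum_(i <- r) g i).
Proof.
elim: r => [|i r IH]; first by rewrite !big_nil.
by rewrite !big_cons IH.
Qed.

(** The mixed terms of real and imaginary parts cancel by symmetry of [q], which reduces positivity
    and strictness to real coefficients. *)
Lemma quadratic_form_real n (x : 'I_n -> X) (c : 'I_n -> C) :
  let a := family_comb (fun i => complex.Re (c i)) x in
  let b := family_comb (fun i => complex.Im (c i)) x in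
  quadratic_form K x c = Complex (qf q a a + qf q b b) 0.
Proof.
move=> a b; rewrite /quadratic_form.
pose re i := complex.Re (c i); pose im i := complex.Im (c i).
have term i j : c i * Num.conj (c j) * K (x i) (x j) =
    Complex (re i * (re j * q (x i) (x j)) + im i * (im j * q (x i) (x j)))
            (im i * (re j * q (x i) (x j)) - re i * (im j * q (x i) (x j))).
  rewrite /re /im /to_complex; case: (c i) (c j) => [a1 b1] [a2 b2].
  by rewrite conj_complex; apply/eqP; rewrite eq_complex /=; apply/andP; split;
    apply/eqP; ring.
under eq_bigr do (under eq_bigr do rewrite term; rewrite sum_complex).
rewrite sum_complex.
have e (f g : 'I_n -> R) : qf q (family_comb f x) (family_comb g x) =
    \sum_(i < n) \sum_(j < n) f i * (g j * q (x i) (x j)).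
  by rewrite /qf lin_family; apply: eq_bigr => i _; rewrite lin_family mulr_sumr.
congr Complex.
  by rewrite !e -big_split; apply: eq_bigr => i _; rewrite -big_split.
have := qf_sym b a (proj1 qP); rewrite !e => /eqP; rewrite -subr_eq0 => /eqP.
move=> h; rewrite -[RHS]h -sumrB; apply: eq_bigr => i _.
by rewrite -sumrB.
Qed.

Lemma to_complex_positive_definite : positive_definite K.
Proof.
move=> n x c _; rewrite quadratic_form_real.
by rewrite (ler0c (_ + _)) addr_ge0// (proj2 qP).
Qed.

End ComplexRKHS.

(** * The Stone-Weierstrass theorem *)

(** Stands in for finite subcovers. If [P A] failed, the sets S with [P (A minus S)] would form a
    proper filter; at a cluster point x, the complement of the good neighbourhood of x belongs to
    the filter, which is absurd. *)
Lemma compact_induction (X : topologicalType) (A : set X) (P : set X -> Prop) :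
  compact A -> P set0 -> (forall S T, S `<=` T -> P T -> P S) ->
  (forall S T, P S -> P T -> P (S `|` T)) ->
  (forall x, A x -> exists2 U, nbhs x U & P (A `&` U)) -> P A.
Proof.
move=> Ac P0 Psub PU Ploc; apply: contrapT => nPA.
pose F : set_system X := [set S | P (A `\` S)].
have FF : ProperFilter F.
  split; first by rewrite /F /= setD0.
  split; rewrite /F /=; first by rewrite setDT.
  - by move=> S T PS PT; rewrite /= setDIr; exact: PU.
  - by move=> S T ST; apply: Psub; exact: setDS.
have [|x [Ax /(_ (~` _)) xF]] := Ac F FF; first by rewrite /F /= setDv.
have [U xU PAU] := Ploc x Ax.
have [|y [nUy Uy]] := xF U U _ xU; first by rewrite /F /= setDE setCK.
exact: nUy.
Qed.

Lemma within_continuous_near (R : realType) (X : topologicalType) (A : set X)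
    (h : X -> R) (x : X) (e : R) :
  {within A, continuous h} -> A x -> 0 < e ->
  exists2 U, nbhs x U & forall y, A y -> U y -> `|h y - h x| < e.
Proof.
move=> /subspace_continuousP /(_ x) + Ax e0 => /(_ Ax) /cvgrPdist_lt /(_ e e0) h'.
exists [set y | A y -> `|h y - h x| < e]; last by move=> y Ay; apply.
move: h'; rewrite near_withinE => h'; apply: filterS h' => y hy Ay.
by rewrite distrC; exact: hy.
Qed.

Lemma compact_within_bounded (R : realType) (X : topologicalType) (A : set X)
    (h : X -> R) : compact A -> {within A, continuous h} ->
  exists2 M, 0 < M & forall x, A x -> `|h x| <= M.
Proof.
move=> Ac hc.
apply: (compact_induction
  (P := fun S => exists2 M, 0 < M & forall x, S x -> `|h x| <= M)) Ac _ _ _ _.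
- by exists 1.
- by move=> S T ST [M M0 hM]; exists M => // x /ST; exact: hM.
- move=> S T [M1 M10 h1] [M2 M20 h2]; exists (M1 + M2); first exact: addr_gt0.
  by move=> x [/h1|/h2] => /le_trans; apply; rewrite ?lerDl ?lerDr ltW.
- move=> x Ax; have [U xU hU] := within_continuous_near hc Ax ltr01.
  exists U => //; exists (`|h x| + 1) => [|y [Ay /(hU _ Ay)]].
    by rewrite ltr_wpDl.
  by have := ler_normD (h y - h x) (h x); rewrite subrK; lra.
Qed.

Section AbsPolynomial.
Context {R : realType}.

(* The classical iteration r + (s^2 - r^2) / 2, which increases to |s| on the
   interval [-1, 1]. *)
Fixpoint abs_iter (n : nat) (s : R) : R :=
  if n is n'.+1 then abs_iter n' s + (s ^+ 2 - abs_iter n' s ^+ 2) / 2 else 0.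

(** A step multiplies the error by 1 - (t + r)/2 <= 1 - t/2, where t = |s|, and (1 - t/2)(1 + (n+1)
    t/2) <= 1 + n t/2. The third bound yields a rate uniform in s although convergence slows down
    near 0. *)
Lemma abs_iter_bounds n (s : R) : `|s| <= 1 ->
  [/\ 0 <= abs_iter n s, abs_iter n s <= `|s| &
      (`|s| - abs_iter n s) * (1 + n%:R * `|s| / 2) <= `|s|].
Proof.
move=> s1; elim: n => [|n [r0 rs h]] /=.
  by rewrite subr0 mul0r mul0r addr0 mulr1.
have s0 := normr_ge0 s.
rewrite -(real_normK (num_real s)).
set t := `|s| in s1 rs h s0 *; set r := abs_iter n s in r0 rs h *.
have n0 : 0 <= n%:R :> R by [].
have rt : r ^+ 2 <= t ^+ 2 by rewrite ler_pXn2r// nnegrE (le_trans r0).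
split.
- by apply: addr_ge0 => //; rewrite divr_ge0// subr_ge0.
- have -> : r + (t ^+ 2 - r ^+ 2) / 2 = t - (t - r) * (1 - (t + r) / 2) by field.
  rewrite lerBlDr lerDl; apply: mulr_ge0; lra.
- have -> : t - (r + (t ^+ 2 - r ^+ 2) / 2) = (t - r) * (1 - (t + r) / 2) by field.
  apply: le_trans h; rewrite -mulrA ler_wpM2l ?subr_ge0// -natr1.
  rewrite -subr_ge0; set D := (X in 0 <= X).
  have -> : D = (r + (t + r) * (n%:R * t + t) / 2) / 2 by rewrite /D; field.
  rewrite divr_ge0// addr_ge0// divr_ge0// mulr_ge0//; first exact: addr_ge0.
  by apply: addr_ge0 => //; exact: mulr_ge0.
Qed.

Lemma abs_iter_approx n (s : R) : `|s| <= 1 ->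
  `|abs_iter n.+1 s - `|s| | <= 2 / n.+1%:R.
Proof.
move=> /(abs_iter_bounds n.+1)[]; set r := abs_iter _ s => r0 rs h.
rewrite distrC ger0_norm ?subr_ge0// ler_pdivlMr ?ltr0n//.
have [s0|s0] := eqVneq `|s| 0.
  have -> : r = 0 by apply/le_anti; rewrite r0 -s0 rs.
  by rewrite s0 subr0 mul0r.
have {}s0 : 0 < `|s| by rewrite lt_def s0 normr_ge0.
rewrite -(ler_pM2r s0); nra.
Qed.

End AbsPolynomial.

Section StoneWeierstrass.
Context {R : realType} {X : topologicalType}.
Variables (A : set X) (B : set (X -> R)).
Hypothesis Ac : compact A.
Hypothesis Bcont : forall p, B p -> {within A, continuous p}.
Hypothesis B1 : B (fun=> 1).
Hypothesis Blincomb : forall a p1 p2, B p1 -> B p2 ->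
  B (fun x => a * p1 x + p2 x).
Hypothesis BM : forall p1 p2, B p1 -> B p2 -> B (fun x => p1 x * p2 x).
Hypothesis Bsep : forall x y, A x -> A y -> x <> y ->
  exists2 p, B p & p x <> p y.

Let BC c : B (fun=> c).
Proof.
have := Blincomb (c - 1) B1 B1.
by congr B; apply/funext => x; rewrite mulr1 subrK.
Qed.

Let BZ c p : B p -> B (fun x => c * p x).
Proof.
move=> Bp; have := Blincomb c Bp (BC 0).
by congr B; apply/funext => x; rewrite addr0.
Qed.

Definition unif_closure : set (X -> R) :=
  [set h | forall e : R, 0 < e ->
    exists2 p, B p & forall x, A x -> `|p x - h x| <= e].

Lemma sub_unif_closure : B `<=` unif_closure.
Proof. by move=> p Bp e e0; exists p => // x _; rewrite subrr normr0 ltW. Qed.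

Lemma unif_closure_lincomb a h1 h2 : unif_closure h1 -> unif_closure h2 ->
  unif_closure (fun x => a * h1 x + h2 x).
Proof.
move=> c1 c2 e e0; have a0 : 0 < 2 * (`|a| + 1) by rewrite mulr_gt0// ltr_wpDl.
have [p1 Bp1 d1] := c1 _ (divr_gt0 e0 a0).
have [p2 Bp2 d2] := c2 _ (divr_gt0 e0 (ltr0n R 2)).
exists (fun x => a * p1 x + p2 x) => [|x Ax]; first exact: Blincomb.
have -> : a * p1 x + p2 x - (a * h1 x + h2 x) = a * (p1 x - h1 x) + (p2 x - h2 x).
  by ring.
apply: le_trans (ler_normD _ _) _; rewrite normrM.
have := d2 x Ax; have := d1 x Ax; rewrite (ler_pdivlMr _ _ a0).
have := normr_ge0 (p1 x - h1 x); have := normr_ge0 a; nra.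
Qed.

Lemma abs_iter_mem n p : B p -> B (fun x => abs_iter n (p x)).
Proof.
move=> Bp; elim: n => [|n IH] /=; first exact: BC.
have := Blincomb (2^-1) (Blincomb (-1) (BM IH IH) (BM Bp Bp)) IH.
by congr B; apply/funext => x; field.
Qed.

Lemma unif_closure_abs h : unif_closure h -> unif_closure (fun x => `|h x|).
Proof.
move=> ch e e0; have [p Bp dp] := ch _ (divr_gt0 e0 (ltr0n R 2)).
have [M M0 pM] := compact_within_bounded Ac (Bcont Bp).
(* After rescaling [p] by its bound [M], the error of the iteration is at most 2 M / (n + 1), which
   has to stay below e / 2. *)
have [n Hn] : exists n : nat, 4 * M / e < n.+1%:R.
  exists (Num.truncn (4 * M / e)); exact: truncnS_gt.
exists (fun x => M * abs_iter n.+1 (M^-1 * p x)).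
  by apply: BZ; apply: abs_iter_mem; exact: BZ.
move=> x Ax.
have s1 : `|M^-1 * p x| <= 1.
  by rewrite normrM gtr0_norm ?invr_gt0// ler_pdivrMl// mulr1; exact: pM.
have h1 := abs_iter_approx n s1.
have -> : M * abs_iter n.+1 (M^-1 * p x) - `|h x| =
  M * (abs_iter n.+1 (M^-1 * p x) - `|M^-1 * p x|) + (`|p x| - `|h x|).
  by rewrite normrM gtr0_norm ?invr_gt0//; field; rewrite gt_eqF.
apply: le_trans (ler_normD _ _) _; rewrite normrM (gtr0_norm M0).
have h2 : `| `|p x| - `|h x| | <= e / 2.
  by apply: le_trans (ler_dist_dist _ _) (dp x Ax).
have h3 : M * `|abs_iter n.+1 (M^-1 * p x) - `|M^-1 * p x| | <= e / 2.
  apply: le_trans (ler_wpM2l (ltW M0) h1) _.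
  rewrite mulrA ler_pdivrMr ?ltr0n//; move: Hn; rewrite ltr_pdivrMr//; nra.
by have := lerD h3 h2; rewrite -splitr.
Qed.

Lemma unif_closure_max h1 h2 : unif_closure h1 -> unif_closure h2 ->
  unif_closure (fun x => Num.max (h1 x) (h2 x)).
Proof.
move=> c1 c2; have cD := unif_closure_lincomb (-1) c1 c2.
(* With D = h2 - h1, the maximum is |D|/2 + (D/2 + h1). *)
have := unif_closure_lincomb (2^-1) (unif_closure_abs cD)
  (unif_closure_lincomb (2^-1) cD c1).
congr unif_closure; apply/funext => x; have [h|h] := lerP (h1 x) (h2 x).
- by rewrite (@ger0_norm _ (-1 * h1 x + h2 x)); lra.
- by rewrite (@ltr0_norm _ (-1 * h1 x + h2 x)); lra.
Qed.

Lemma unif_closure_min h1 h2 : unif_closure h1 -> unif_closure h2 ->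
  unif_closure (fun x => Num.min (h1 x) (h2 x)).
Proof.
move=> c1 c2; have cD := unif_closure_lincomb (-1) c1 c2.
have := unif_closure_lincomb (- 2^-1) (unif_closure_abs cD)
  (unif_closure_lincomb (2^-1) cD c1).
congr unif_closure; apply/funext => x; have [h|h] := lerP (h1 x) (h2 x).
- by rewrite (@ger0_norm _ (-1 * h1 x + h2 x)); lra.
- by rewrite (@ltr0_norm _ (-1 * h1 x + h2 x)); lra.
Qed.

Lemma two_point_interpolation x y (a b : R) : A x -> A y -> x <> y ->
  exists2 p, B p & p x = a /\ p y = b.
Proof.
move=> Ax Ay xy; have [p Bp pxy] := Bsep Ax Ay xy.
have d0 : p x - p y != 0 by rewrite subr_eq0; exact/eqP.
exists (fun z => (a - b) / (p x - p y) * p z +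
                 (b - (a - b) / (p x - p y) * p y)).
  exact: Blincomb.
by split; field.
Qed.

Theorem stone_weierstrass h : {within A, continuous h} -> unif_closure h.
Proof.
move=> hc e e0; have [d d0 ed] : exists2 d, 0 < d & e = 5 * d.
  by exists (e / 5); [rewrite divr_gt0|field].
have near p x : B p -> A x -> exists2 U, nbhs x U & forall y, A y -> U y ->
    `|p y - p x| < d / 2 /\ `|h y - h x| < d / 2.
  move=> Bp Ax; have d20 : 0 < d / 2 by rewrite divr_gt0.
  have [U xU hU] := within_continuous_near (Bcont Bp) Ax d20.
  have [V xV hV] := within_continuous_near hc Ax d20.
  by exists (U `&` V) => [|y Ay [/(hU _ Ay) ? /(hV _ Ay)]]; first exact: filterI.
(* Maxima of two-point interpolants through x give [g]. It is then replaced by some [p] in [B], at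
   the cost of another d, because [near] controls oscillation for members of [B]. *)
have above x : A x -> exists2 p, B p &
    p x < h x + 2 * d /\ forall y, A y -> h y - 2 * d < p y.
  move=> Ax; suff [g cg [gx gh]] : exists2 g, unif_closure g &
      g x < h x + d /\ forall y, A y -> h y - d < g y.
    have [p Bp dp] := cg _ d0; exists p => //; split=> [|y Ay].
      by have := dp x Ax; rewrite ler_norml => /andP[? ?]; lra.
    have := gh y Ay; have := dp y Ay; rewrite ler_norml => /andP[? ?]; lra.
  apply: (compact_induction (P := fun S => exists2 g, unif_closure g &
      g x < h x + d /\ forall y, S y -> h y - d < g y)) Ac _ _ _ _.
  - exists (fun=> h x); first exact/sub_unif_closure/BC.
    by split=> //; rewrite ltrDl.
  - by move=> S T ST [g cg [gx gh]]; exists g => //; split=> // y /ST; exact: gh.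
  - move=> S T [g1 c1 [gx1 gh1]] [g2 c2 [gx2 gh2]].
    exists (fun y => Num.max (g1 y) (g2 y)); first exact: unif_closure_max.
    split=> [|y [/gh1|/gh2]]; first by rewrite gt_max gx1.
      by rewrite lt_max => ->.
    by rewrite lt_max => ->; rewrite orbT.
  - move=> y Ay; have [p Bp [px py]] : exists2 p, B p & p x = h x /\ p y = h y.
      have [<-|xy] := pselect (x = y); first by exists (fun=> h x).
      exact: two_point_interpolation.
    have [U yU hU] := near p y Bp Ay; exists U => //.
    exists p; first exact: sub_unif_closure.
    split=> [|z [Az Uz]]; first by rewrite px ltrDl.
    have [] := hU z Az Uz; rewrite !ltr_norml py => /andP[? ?] /andP[? ?]; lra.
suff [g cg gh] : exists2 g, unif_closure g & forall y, A y ->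
    h y - 2 * d < g y /\ g y < h y + 3 * d.
  have [p Bp dp] := cg _ d0; exists p => // x Ax.
  have [h1 h2] := gh x Ax; have := dp x Ax; rewrite !ler_norml => /andP[? ?].
  by apply/andP; split; lra.
(* Splitting the bounds lets the induction extend the upper one from set to set, while the lower one
   holds on all of [A] throughout and survives minima. *)
suff [g cg [g1 g2]] : exists2 g, unif_closure g &
    (forall y, A y -> h y - 2 * d < g y) /\ forall y, A y -> g y < h y + 3 * d.
  by exists g => // y Ay; split; [exact: g1|exact: g2].
apply: (compact_induction (P := fun S => exists2 g, unif_closure g &
    (forall y, A y -> h y - 2 * d < g y) /\
    forall y, S y -> g y < h y + 3 * d)) Ac _ _ _ _.
- have [M M0 hM] := compact_within_bounded Ac hc.
  exists (fun=> M); first exact/sub_unif_closure/BC.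
  by split=> // y Ay; have := hM y Ay; rewrite ler_norml => /andP[]; lra.
- by move=> S T ST [g cg [g1 g2]]; exists g => //; split=> // y /ST; exact: g2.
- move=> S T [g1 c1 [l1 u1]] [g2 c2 [l2 u2]].
  exists (fun y => Num.min (g1 y) (g2 y)); first exact: unif_closure_min.
  split=> [y Ay|y [/u1|/u2]]; first by rewrite lt_min l1 ?l2.
    by rewrite gt_min => ->.
  by rewrite gt_min => ->; rewrite orbT.
- move=> x Ax; have [p Bp [px pl]] := above x Ax.
  have [U xU hU] := near p x Bp Ax; exists U => //.
  exists p; first exact: sub_unif_closure.
  split=> // z [Az Uz].
  have [] := hU z Az Uz; rewrite !ltr_norml => /andP[? ?] /andP[? ?]; lra.
Qed.

End StoneWeierstrass.

(** * The kernel 1/L *)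

Lemma normr_Re_le (R : realType) (z : cplx R) :
  `|complex.Re z| <= complex.Re `|z|.
Proof.
have /(_ z) := @normc_ge_Re R; rewrite [X in _ <= X](_ : _ = `|z|)//.
by rewrite lecE => /andP[].
Qed.

Lemma normr_Im_le (R : realType) (z : cplx R) :
  `|complex.Im z| <= complex.Re `|z|.
Proof.
have -> : complex.Re `|z| = Num.sqrt (complex.Re z ^+ 2 + complex.Im z ^+ 2).
  by rewrite (normc_def z).
by rewrite -sqrtr_sqr ler_wsqrtr// lerDr sqr_ge0.
Qed.

Lemma Re_normr_le (R : realType) (z : cplx R) :
  complex.Re `|z| <= `|complex.Re z| + `|complex.Im z|.
Proof.
have -> : complex.Re `|z| = Num.sqrt (complex.Re z ^+ 2 + complex.Im z ^+ 2).
  by rewrite (normc_def z).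
have a0 := normr_ge0 (complex.Re z); have b0 := normr_ge0 (complex.Im z).
rewrite -(@ler_pXn2r _ 2) ?nnegrE ?sqrtr_ge0 ?addr_ge0//.
rewrite sqr_sqrtr ?addr_ge0 ?sqr_ge0// sqrrD !real_normK ?num_real//.
by have := mulr_ge0 a0 b0; nra.
Qed.

(** Radii in the topology of [cplx R] are themselves elements of the complex field; [0 < e] makes
    such a radius real. *)
Lemma normr_complex_lt (R : realType) (z e : cplx R) : 0 < e ->
  `|complex.Re z| + `|complex.Im z| < complex.Re e -> `|z| < e.
Proof.
move=> e0 h; have : 0 <= `|z| by [].
move: e0; rewrite lecE !ltcE => /andP[/eqP -> _] /andP[/eqP -> _].
by rewrite eqxx (le_lt_trans (Re_normr_le z)).
Qed.

Section ContinuousKernel.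
Context {R : realType} {X : topologicalType}.
Variable q : X -> X -> R.
Hypothesis qP : psd q.
Hypothesis qc : continuous (fun p : X * X => q p.1 p.2).

Lemma continuous_kernelr x : continuous (q x).
Proof.
move=> y; apply: (@continuous_comp _ _ _ (fun y => (x, y))
  (fun p : X * X => q p.1 p.2)); last exact: qc.
by apply: cvg_pair => /=; [exact: cvg_cst|exact: cvg_id].
Qed.

Lemma continuous_kernel_diag : continuous (fun x => q x x).
Proof.
move=> y; apply: (@continuous_comp _ _ _ (fun y => (y, y))
  (fun p : X * X => q p.1 p.2)); last exact: qc.
by apply: cvg_pair => /=; exact: cvg_id.
Qed.

Lemma rk_continuous F : rk_mem q F -> continuous F.
Proof.
move=> FH x; apply/cvgrPdist_lt => e e0.
have N0 := rk_norm2_ge0 qP FH.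
have d0 : 0 < e ^+ 2 / (rk_norm2 q F + 1).
  by rewrite divr_gt0 ?exprn_gt0// ltr_wpDl.
have h : q x x + q y y - 2 * q x y @[y --> x] --> q x x + q x x - 2 * q x x.
  apply: cvgB; last by apply: cvgM; [exact: cvg_cst|exact: continuous_kernelr].
  by apply: cvgD; [exact: cvg_cst|exact: continuous_kernel_diag].
move/cvgrPdist_lt : h => /(_ _ d0); apply: filterS => y.
have -> : q x x + q x x - 2 * q x x = 0 by ring.
rewrite sub0r normrN => /ltr_normlW hy.
rewrite -(@ltr_pXn2r _ 2) ?nnegrE// ?(ltW e0)// real_normK ?num_real//.
apply: le_lt_trans (rk_oscillation_le qP x y FH) _.
move: hy; rewrite ltr_pdivlMr ?ltr_wpDl// => hy.
have := exprn_gt0 2 e0; nra.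
Qed.

End ContinuousKernel.

Section LogConditional.
Context {R : realType} {X : topologicalType}.
Variable L : X -> X -> R.
Hypothesis hL : log_conditional L.
Local Notation g := (log_kernel L).
Local Notation q := (inverse_kernel L).

Let L_gt0 x y : 0 < L x y.
Proof. by case: hL => /(_ x y) h _ _; exact: lt_le_trans h. Qed.

Let LC x y : L x y = L y x.
Proof. by case: hL => _ h _; exact: h. Qed.

Let gP : cond_negative_definite g.
Proof. by case: hL. Qed.

Lemma inverse_kernel_exp x y : q x y = expR (- g x y).
Proof. by rewrite expRN /log_kernel lnK// posrE. Qed.

(** Since -g(x,y) = k(x,y) - g(x,z) - g(z,y) + g(z,z), the constant g(z,z) is shared equally between
    the two factors. *)
Definition weight z x := expR (g z z / 2 - g x z).

Lemma inverse_kernel_factor z x y :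
  q x y = weight z x * weight z y * expR (centered_kernel g z x y).
Proof.
rewrite inverse_kernel_exp -!expRD; congr expR; rewrite /centered_kernel.
by rewrite (proj1 gP z y); field.
Qed.

Lemma inverse_kernel_psd : psd q.
Proof.
split=> [x y|v]; first by rewrite /inverse_kernel LC.
(* The base point is taken from the combination, as [X] may be empty. *)
case: v => [|[c z] w]; first by rewrite /qf lin_nil.
have kP := psd_congr (weight z) (psd_expR (centered_kernel_psd z gP)).
rewrite (@eq_qf _ _ _ (fun x y =>
  weight z x * weight z y * expR (centered_kernel g z x y))).
  exact: (proj2 kP).
by move=> x y; exact: inverse_kernel_factor.
Qed.

Lemma weighted_exp_algebra_mem z p : exp_algebra (centered_kernel g z) p ->
  rk_mem q (fun x => weight z x * p x).
Proof.
move=> /exp_algebra_dominated /(dominated_congr (weight z)) [C C0 h].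
apply: dominated_sqr_le; exists C => //.
by apply: psd_ext h => x y; rewrite -inverse_kernel_factor.
Qed.

Lemma exp_algebra_separates z x y : log_metrizable L -> x <> y ->
  exists2 p, exp_algebra (centered_kernel g z) p & p x <> p y.
Proof.
move=> Lm xy; have kP := centered_kernel_psd z gP.
have [e1|] :=
  pselect (centered_kernel g z x x = centered_kernel g z x y); last first.
  by exists (centered_kernel g z x) => //; exact: exp_algebra_section.
exists (centered_kernel g z y); first exact: exp_algebra_section.
move: e1; have := Lm x y xy; rewrite /centered_kernel.
rewrite (proj1 gP y x) (proj1 gP y z) (proj1 gP x z); lra.
Qed.

(** A Lagrange basis: the product over j of functions equal to 1 at [x i] and 0 at [x j], with the
    factor 1 for j = i. *)
Lemma exp_algebra_dual z n (x : 'I_n -> X) i : log_metrizable L -> injective x ->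
  exists2 p, exp_algebra (centered_kernel g z) p &
    forall j, p (x j) = (j == i)%:R.
Proof.
move=> Lm xI; have kP := centered_kernel_psd z gP.
have /choice[P HP] : forall j, exists p, exp_algebra (centered_kernel g z) p /\
    (p (x i) = 1 /\ (j != i -> p (x j) = 0)).
  move=> j; have [->|ji] := eqVneq j i.
    by exists (fun=> 1); split; [exact: exp_algebra1|].
  have [||||p Bp [p1 p2]] := @two_point_interpolation R X setT
    (exp_algebra (centered_kernel g z)) _ _ _ (x i) (x j) 1 0 I I.
  - exact: exp_algebra1.
  - exact: exp_algebra_lincomb.
  - by move=> u v _ _; exact: exp_algebra_separates.
  - by move/xI => ij; rewrite ij eqxx in ji.
  - by exists p.
exists (fun y => \prod_(j < n) P j y) => [|j].
  elim: (index_enum _) => [|j r IH].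
    have -> : (fun y => \prod_(j <- [::]) P j y) = (fun=> 1).
      by apply/funext => y; rewrite big_nil.
    exact: exp_algebra1.
  have -> : (fun y => \prod_(j <- j :: r) P j y) =
      (fun y => P j y * \prod_(j <- r) P j y).
    by apply/funext => y; rewrite big_cons.
  by apply: exp_algebraM => //; exact: (HP j).1.
have [->|ji] := eqVneq j i.
  by rewrite big1// => k _; exact: (HP k).2.1.
by rewrite (bigD1 j)//= (HP j).2.2// mul0r.
Qed.

(** The weighted dual function is a bounded functional whose value on the combination is [a i] times
    a positive weight; a vanishing form forces that value to be 0. *)
Lemma metrizable_real_strict n (x : 'I_n -> X) (a : 'I_n -> R) :
  log_metrizable L -> injective x ->
  qf q (family_comb a x) (family_comb a x) = 0 -> forall i, a i = 0.
Proof.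
move=> Lm xI a0 i; have [p Bp px] := exp_algebra_dual (x i) i Lm xI.
have [C _ /(_ (family_comb a x))] := weighted_exp_algebra_mem Bp.
rewrite a0 mulr0 lin_family (bigD1 i)//= px eqxx mulr1 big1 ?addr0; last first.
  by move=> j /negbTE ji; rewrite px ji !mulr0.
move=> h; have : a i * weight (x i) (x i) == 0.
  by rewrite -sqrf_eq0 eq_le h sqr_ge0.
by rewrite mulf_eq0 [weight _ _ == 0]gt_eqF ?expR_gt0// orbF => /eqP.
Qed.

Lemma metrizable_strictly_positive_definite :
  log_metrizable L -> strictly_positive_definite (to_complex q).
Proof.
move=> Lm; have qP := inverse_kernel_psd.
split=> [|n x c xI]; first exact: to_complex_positive_definite.
rewrite quadratic_form_real//; set a := family_comb _ _; set b := family_comb _ _.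
move=> [h] i; have a0 := proj2 qP a; have b0 := proj2 qP b.
have {}a0 : qf q a a = 0 by lra.
have {}b0 : qf q b b = 0 by lra.
have := metrizable_real_strict Lm xI a0 i.
have := metrizable_real_strict Lm xI b0 i.
by case: (c i) => u v /= -> ->.
Qed.

Lemma not_metrizable_degenerate : ~ log_metrizable L ->
  exists x y, x <> y /\ q x y ^+ 2 = q x x * q y y.
Proof.
move=> nLm; apply: contrapT => h; apply: nLm => x y xy.
rewrite lt_neqAle; apply/andP; split.
  apply/eqP => e; apply: h; exists x, y; split=> //.
  by rewrite !inverse_kernel_exp expr2 -!expRD; congr expR; lra.
have := @cond_negative_definite_qf _ _ _ [:: (1, x); (-1, y)] gP.
rewrite !lin_cons lin_nil /= => /(_ _).
rewrite /qf !lin_cons !lin_nil /= (proj1 gP y x); lra.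
Qed.

Lemma strictly_positive_definite_metrizable :
  strictly_positive_definite (to_complex q) -> log_metrizable L.
Proof.
move=> [_ qS]; apply: contrapT => /not_metrizable_degenerate[x [y [xy e]]].
have qP := inverse_kernel_psd.
have qxy : 0 < q x y by rewrite invr_gt0.
pose s (i : 'I_2) := if i == 0 then x else y.
(* The vector (q(x,y), -q(x,x)) lies in the kernel of the singular Gram matrix, and its first entry
   is positive. *)
pose c (i : 'I_2) : cplx R :=
  real_complex R (if i == 0 then q x y else - q x x).
have sI : injective s.
  move=> i j; rewrite /s; case: (unliftP 0 i) => [i'|] ->;
    case: (unliftP 0 j) => [j'|] -> //=; rewrite ?(ord1 i') ?(ord1 j')//.
  - by move/esym.
have := qS 2%N s c sI; rewrite quadratic_form_real// => /(_ _ 0).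
do 2!rewrite ?/qf !lin_family !big_ord_recl !big_ord0.
rewrite /s /c /= !mul0r !addr0 (proj1 qP y x) => h.
have [] : c 0 = 0.
  apply: h; congr Complex.
  transitivity (- q x x * (q x y ^+ 2 - q x x * q y y)); first by ring.
  by rewrite e subrr mulr0.
move=> h'; move: qxy.
by rewrite h' ltxx.
Qed.

(** Degeneracy forces one linear relation between F(x) and F(y) for all F in the space, whereas
    universality asks for F near 1 at x and near 0 at y. *)
Lemma universal_metrizable : hausdorff_space X ->
  universal_kernel (to_complex q) -> log_metrizable L.
Proof.
move=> Xh [_ [H [ip [HK _ Hu]]]].
apply: contrapT => /not_metrizable_degenerate[x [y [xy e]]].
have qC := proj1 inverse_kernel_psd.
have qxy : 0 < q x y by rewrite invr_gt0.
have qxx : 0 < q x x by rewrite invr_gt0.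
have [HH Hs Hr _] := HK; have [H0 Hlin ipl iph _ ip0 _] := HH.
pose kx := kernel_section (to_complex q) x.
pose ky := kernel_section (to_complex q) y.
pose a : cplx R := real_complex R (q x y).
pose b : cplx R := real_complex R (- q x x).
have Kx : H kx by exact: Hs.
have Ky : H ky by exact: Hs.
have Hb : H (b *: ky) by have := Hlin b ky 0 Ky H0; rewrite addr0.
have ip0l F : H F -> ip 0 F = 0.
  move=> FH; have := ipl 1 0 0 F H0 H0 FH; rewrite scale1r addr0 mul1r.
  by move=> h; apply: (addIr (ip 0 F)); rewrite -h add0r.
pose E := a *: kx + b *: ky; have EH : H E by exact: Hlin.
have ipE F : H F -> ip E F = a * Num.conj (F x) + b * Num.conj (F y).
  move=> FH; rewrite ipl//; have := ipl b ky 0 F Ky H0 FH.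
  rewrite addr0 ip0l// addr0 => ->.
  by rewrite (iph F kx)// (iph F ky)// !Hr.
have Ex z : E z = real_complex R (q x y * q z x - q x x * q z y).
  change (E z) with (a * real_complex R (q z x) + b * real_complex R (q z y)).
  by rewrite /a /b -!rmorphM -rmorphD mulNr.
(* E vanishes at x identically and at y by degeneracy, and <E, E> involves only these two values. *)
have E0 : E = 0.
  apply: ip0 => //; rewrite ipE// !Ex (qC y x) -expr2 e subrr.
  by rewrite [q x y * _]mulrC subrr !rmorph0 !mulr0 addr0.
have dep F : H F -> a * Num.conj (F x) + b * Num.conj (F y) = 0.
  by move=> FH; rewrite -ipE// E0 ip0l.
pose A := [set x; y].
pose g0 : X -> cplx R := fun z => if pselect (z = x) then 1 else 0.
have gc : {within A, continuous g0}.
  apply/subspace_continuousP => z Az.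
  (* Points are closed in a Hausdorff space, so the two-point set [A] is discrete and every function
     on it is continuous. *)
  have [U zU hU] : exists2 U, nbhs z U & forall t, A t -> U t -> t = z.
    have other w : w <> z -> exists2 U, nbhs z U & ~ U w.
      move=> wz; exists (~` [set w]); last by apply.
      apply: open_nbhs_nbhs; split; last by move=> /= zw; apply: wz.
      by apply: closed_openC; apply: accessible_closed_set1;
        exact: hausdorff_accessible.
    move: other; case: Az => -> other.
      have [|U xU nU] := other y; first by move/esym.
      by exists U => // t [->|-> /nU].
    have [|U yU nU] := other x; first by [].
    by exists U => // t [-> /nU|->].
  move=> V gV; rewrite /= /within /=; apply: filterS zU => t Ut At.
  by rewrite /= (hU t At Ut); exact: nbhs_singleton gV.
have Ac : compact A by apply: compactU; exact: compact_set1.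
(* The relation would give q(x,y) (1 - d) < q(x,x) d, so q(x,y) < d (q(x,y) + q(x,x)) = q(x,y)/2. *)
pose d := q x y / (2 * (q x y + q x x)).
have d0 : 0 < d by rewrite divr_gt0// mulr_gt0// addr_gt0.
have [F FH hF] := Hu A g0 d Ac gc d0.
have near z : A z -> complex.Re `|F z - g0 z| < d.
  move=> Az; rewrite -lte_fin; apply: le_lt_trans hF.
  by apply: ereal_sup_ubound; exists z.
have := near x (or_introl erefl); have := near y (or_intror erefl).
have -> : g0 x = 1 by rewrite /g0; case: pselect.
have -> : g0 y = 0 by rewrite /g0; case: pselect => // yx; case: xy.
rewrite subr0.
move=> /(le_lt_trans (normr_Re_le _)) h1 /(le_lt_trans (normr_Re_le _)).
have := dep F FH; move: h1; rewrite /a /b.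
case: (F x) (F y) => [u1 u2] [v1 v2] /= + [+ _].
rewrite !ltr_norml => /andP[h1 h2] h3 /andP[h4 h5].
have : d * (2 * (q x y + q x x)) = q x y.
  by rewrite /d divfK// gt_eqF// mulr_gt0// addr_gt0.
nra.
Qed.

End LogConditional.

Section ContinuousLogConditional.
Context {R : realType} {X : topologicalType}.
Variable L : X -> X -> R.
Hypothesis hLc : continuous (fun p : X * X => L p.1 p.2).
Hypothesis hL : log_conditional L.
Local Notation g := (log_kernel L).
Local Notation q := (inverse_kernel L).

Let L_gt0 x y : 0 < L x y.
Proof. by case: hL => /(_ x y) h _ _; exact: lt_le_trans h. Qed.

Let gc : continuous (fun p : X * X => g p.1 p.2).
Proof.
move=> p; apply: (@continuous_comp _ _ _ (fun p : X * X => L p.1 p.2) (@ln R)).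
  exact: hLc.
exact: continuous_ln.
Qed.

Let gP : cond_negative_definite g.
Proof. by case: hL. Qed.

Lemma continuous_inverse_kernel : continuous (fun p : X * X => q p.1 p.2).
Proof.
by move=> p; apply: cvgV; [rewrite gt_eqF|exact: hLc].
Qed.

Lemma continuous_log_kernell z : continuous (g^~ z).
Proof.
have -> : g^~ z = g z by apply/funext => x; exact: (proj1 gP).
exact: continuous_kernelr.
Qed.

Lemma continuous_weight z : continuous (weight L z).
Proof.
move=> x; apply: (@continuous_comp _ _ _ (fun x => g z z / 2 - g x z) expR).
  by apply: cvgB; [exact: cvg_cst|exact: continuous_log_kernell].
exact: continuous_expR.
Qed.

Lemma continuous_exp_centered_kernel z :
  continuous (fun p : X * X => expR (centered_kernel g z p.1 p.2)).
Proof.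
move=> p; apply: (@continuous_comp _ _ _
  (fun p : X * X => centered_kernel g z p.1 p.2) expR); last first.
  exact: continuous_expR.
apply: cvgB; last exact: cvg_cst.
apply: cvgB; last exact: gc.
apply: cvgD.
  apply: (@continuous_comp _ _ _ fst (g^~ z)); first exact: cvg_fst.
  exact: continuous_log_kernell.
apply: (@continuous_comp _ _ _ snd (g z)); first exact: cvg_snd.
exact: continuous_kernelr.
Qed.

(** The algebra is given by domination, so continuity comes from membership in the space of the
    continuous kernel exp(k). *)
Lemma exp_algebra_continuous z p :
  exp_algebra (centered_kernel g z) p -> continuous p.
Proof.
move=> /exp_algebra_dominated/dominated_sqr_le.
apply: rk_continuous; last exact: continuous_exp_centered_kernel.
by apply: psd_expR; exact: centered_kernel_psd.
Qed.

Lemma metrizable_rk_dense (A : set X) (h : X -> R) (e : R) :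
  log_metrizable L -> compact A -> {within A, continuous h} -> 0 < e ->
  exists2 F, rk_mem q F & forall x, A x -> `|F x - h x| <= e.
Proof.
move=> Lm Ac hc e0.
have [[z _]|noX] := pselect (exists z : X, True); last first.
  exists (fun=> 0) => [|x _]; first exact: rk_mem0.
  by case: noX; exists x.
have kP := centered_kernel_psd z gP.
have wc : continuous (weight L z) by exact: continuous_weight.
have w0 x : weight L z x != 0 by rewrite gt_eqF ?expR_gt0.
have [M M0 wM] := compact_within_bounded Ac (continuous_subspaceT wc).
have hwc : {within A, continuous (fun x => h x / weight L z x)}.
  move=> x; apply: cvgM; first exact: hc.
  by apply: cvgV => //; exact: (continuous_subspaceT wc).
(* The space contains the algebra times the weight, so h divided by the weight is approximated;
   multiplying back costs at most the factor [M]. *)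
have [||||||p Bp hp] := @stone_weierstrass R X A
  (exp_algebra (centered_kernel g z)) Ac _ _ _ _ _ _ hwc (e / M).
- by move=> p /exp_algebra_continuous; exact: continuous_subspaceT.
- exact: exp_algebra1.
- exact: exp_algebra_lincomb.
- exact: exp_algebraM.
- by move=> x y _ _; exact: exp_algebra_separates.
- by rewrite divr_gt0.
exists (fun x => weight L z x * p x); first exact: weighted_exp_algebra_mem.
move=> x Ax; have -> : weight L z x * p x - h x =
    weight L z x * (p x - h x / weight L z x) by field; rewrite w0.
rewrite normrM; apply: le_trans (ler_pM _ _ (wM x Ax) (hp x Ax)) _ => //.
by rewrite mulrC divfK// gt_eqF.
Qed.

Lemma metrizable_universal :
  log_metrizable L -> universal_kernel (to_complex q).
Proof.
move=> Lm; have qP := inverse_kernel_psd hL.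
split; first exact: to_complex_positive_definite.
exists (crk_mem q), (crk_ip q); split; first exact: crk_is_rkhs.
- move=> F [F1 F2] x; apply/cvgrPdist_lt => e e0.
  have re0 : 0 < complex.Re e / 2.
    by move: e0; rewrite ltcE => /andP[_]; rewrite /= => ?; rewrite divr_gt0.
  have c1 : continuous (re_fun F).
    exact: (rk_continuous qP continuous_inverse_kernel F1).
  have c2 : continuous (im_fun F).
    exact: (rk_continuous qP continuous_inverse_kernel F2).
  have /cvgrPdist_lt /(_ _ re0) n1 := c1 x.
  have /cvgrPdist_lt /(_ _ re0) n2 := c2 x.
  near=> y; apply: normr_complex_lt => //.
  have h1 : `|re_fun F x - re_fun F y| < complex.Re e / 2 by near: y.
  have h2 : `|im_fun F x - im_fun F y| < complex.Re e / 2 by near: y.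
  move: h1 h2; rewrite /re_fun /im_fun.
  case: (F x) (F y) => [a b] [c d] /= h1 h2.
  by rewrite [ltRHS]splitr ltrD.
- move=> A f e Ac fc e0.
  have part (pi : cplx R -> R) :
      (forall u v, `|pi u - pi v| <= complex.Re `|u - v|) ->
      {within A, continuous (pi \o f)}.
    move=> piL x; apply/cvgrPdist_lt => d d0.
    have dC0 : 0 < (real_complex R d : cplx R) by rewrite ltcR.
    have /cvgrPdist_lt /(_ _ dC0) := fc x.
    apply: filterS => y hy; apply: le_lt_trans (piL _ _) _.
    by move: hy; rewrite ltcE => /andP[_].
  have fre : {within A, continuous (re_fun f)}.
    apply: (part (@complex.Re R)) => u v; have := normr_Re_le (u - v).
    by congr (`|_| <= _); case: u v => [? ?] [? ?].
  have fim : {within A, continuous (im_fun f)}.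
    apply: (part (@complex.Im R)) => u v; have := normr_Im_le (u - v).
    by congr (`|_| <= _); case: u v => [? ?] [? ?].
  (* Real and imaginary parts add up to e / 2, which leaves room for the strict bound on the
     supremum. *)
  have e40 : 0 < e / 4 by rewrite divr_gt0.
  have [F1 F1H h1] := metrizable_rk_dense Lm Ac fre e40.
  have [F2 F2H h2] := metrizable_rk_dense Lm Ac fim e40.
  exists (fun x => Complex (F1 x) (F2 x) : cplx R) => //.
  apply: (@le_lt_trans _ _ (e / 2)%:E); last first.
    by rewrite lte_fin ltr_pdivrMr// ltr_pMr// ltr1n.
  apply: ge_ereal_sup => _ [x Ax <-]; rewrite lee_fin.
  apply: le_trans (Re_normr_le _) _.
  have := h1 x Ax; have := h2 x Ax; rewrite /re_fun /im_fun.
  case: (f x) => [a b] /= k1 k2; lra.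
Unshelve. all: by end_near. Qed.

End ContinuousLogConditional.

Theorem theorem6p3 (R : realType) (X : topologicalType) (L : X -> X -> R)
    (hX : hausdorff_space X)
    (hLc : continuous (fun p : X * X => L p.1 p.2))
    (hL : log_conditional L) :
  (strictly_positive_definite (to_complex (inverse_kernel L))
     <-> log_metrizable L) /\
  (universal_kernel (to_complex (inverse_kernel L)) <-> log_metrizable L).
Proof.
split; split.
- exact: strictly_positive_definite_metrizable.
- exact: metrizable_strictly_positive_definite.
- exact: universal_metrizable.
- exact: metrizable_universal.
Qed.
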